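(* For every $n\ge1$, every partition $\lambda$ with at most $n$ parts and every $u$, the interpolation polynomials satisfy the difference equation $$q^{-|\lambda|/2}\Bigl(\prod_{1\le i\le n}(1-q^{\lambda_i}t^{n-i}u)\Bigr)\bar P^{*(n)}_\lambda(x_1,\dots,x_n;q,t,s)=\sum_{\sigma\in\{\pm1\}^n}\prod_{1\le i\le n}\frac{(1-sx_i^{\sigma_i})(1-ux_i^{\sigma_i}/s)}{1-x_i^{2\sigma_i}}\prod_{1\le i<j\le n}\frac{1-tx_i^{\sigma_i}x_j^{\sigma_j}}{1-x_i^{\sigma_i}x_j^{\sigma_j}}\;\bar P^{*(n)}_\lambda(x_1q^{\sigma_1/2},\dots,x_nq^{\sigma_n/2};q,t,s\sqrt q).$$
   Context: Let $\mathbb F=\mathbb Q(q,t)$, with a square root $\sqrt q=q^{1/2}$ fixed; $s,u$ are indeterminates. For a partition $\lambda$ with at most $n$ parts let $m_\lambda(x)$ be the orbit sum of $\prod_ix_i^{\lambda_i}$ under the group $BC_n$ of permutations of $x_1,\dots,x_n$ and inversions $x_i\mapsto x_i^{-1}$. Dominance: $\mu\le\lambda$ iff $\mu_1+\dots+\mu_k\le\lambda_1+\dots+\lambda_k$ for all $k\ge1$ (the sizes may differ). The interpolation polynomial $\bar P^{*(n)}_\lambda(x_1,\dots,x_n;q,t,s)$ is the unique $BC_n$-symmetric Laurent polynomial with coefficients in $\mathbb F(s)$ of the form $m_\lambda+\sum_{\mu<\lambda}c_{\lambda\mu}m_\mu$ which vanishes at $x_i=q^{\mu_i}t^{n-i}s$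 ($1\le i\le n$) for all partitions $\mu<\lambda$ with at most $n$ parts; it then vanishes at this point for every partition $\mu$ with at most $n$ parts and $\lambda\not\subset\mu$. *)

(* Defs.v *)
From HB Require Import structures.
From mathcomp Require Import all_boot all_order all_algebra all_fingroup.
From mathcomp Require Import generic_quotient finmap.
From mathcomp Require Import monalg.
From mathcomp Require Import mpoly.

Set Implicit Arguments.
Unset Strict Implicit.
Unset Printing Implicit Defensive.

Import GRing.Theory.
Local Open Scope ring_scope.

(* Both monalg and mpoly define this notation; the latter is meant. *)
Notation "{ 'mpoly' T [ n ] }" := (mpoly.mpoly n T) : type_scope.

Notation "x %:F" := (@FracField.tofrac _ x) : ring_scope.

(* The map of fraction fields x / y |-> f x / f y; it is meaningful (and a
   ring morphism) when f is injective. *)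
Definition frac_map (A B : idomainType) (f : A -> B)
    (z : {fraction A}) : {fraction B} :=
  (f \n_(repr z))%:F / (f \d_(repr z))%:F.

Section FracMap.
Variables (A B : idomainType) (f : {rmorphism A -> B}).
Hypothesis f_inj : forall x, f x = 0 -> x = 0.

Lemma frac_repr (z : {fraction A}) :
  z = (\n_(repr z))%:F / (\d_(repr z))%:F.
Proof.
have dn0 := denom_ratioP (repr z).
apply: (canRL (mulfK _)); first by rewrite tofrac_eq0.
rewrite -{1}[z]reprK; move: (repr z) dn0 => {z} w dn0.
rewrite -[_ * _]/(FracField.mul _ _) /FracField.tofrac.
unlock; rewrite -FracField.pi_mul; apply/eqP.
rewrite FracField.equivf_def /FracField.equivf.
by rewrite /FracField.mulf !numden_Ratio ?mulr1 ?oner_neq0 ?mulf_neq0 // mulrC.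
Qed.

Lemma frac_map_div (x y : A) : y != 0 ->
  frac_map f (x%:F / y%:F) = (f x)%:F / (f y)%:F.
Proof.
move=> y0; set z : {fraction A} := x%:F / y%:F; rewrite /frac_map.
have f0 w : w != 0 -> (f w)%:F != 0 :> {fraction B}.
  by rewrite tofrac_eq0; apply: contraNneq => /f_inj ->.
have dn0 := denom_ratioP (repr z).
apply/eqP; rewrite eqr_div ?f0 // -!tofracM -!rmorphM; apply/eqP.
congr (f _)%:F; apply/eqP; rewrite -tofrac_eq !tofracM.
by rewrite -eqr_div ?tofrac_eq0 // -frac_repr.
Qed.

Lemma frac_map_zmod_morphism : zmod_morphism (frac_map f).
Proof.
move=> a b.
have [da db] := (denom_ratioP (repr a), denom_ratioP (repr b)).
have f0 w : w != 0 -> (f w)%:F != 0 :> {fraction B}.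
  by rewrite tofrac_eq0; apply: contraNneq => /f_inj ->.
rewrite {1}[a]frac_repr {1}[b]frac_repr -mulNr -tofracN addf_div ?tofrac_eq0 //.
rewrite -!tofracM -tofracD frac_map_div ?mulf_neq0 //.
by rewrite !rmorphD !rmorphM !rmorphN -addf_div ?f0 // mulNr.
Qed.

Lemma frac_map_monoid_morphism : monoid_morphism (frac_map f).
Proof.
split.
  have {1}-> : 1 = 1%:F / 1%:F :> {fraction A} by rewrite divff ?tofrac_eq0 ?oner_eq0.
  by rewrite frac_map_div ?oner_neq0 // rmorph1 divff ?tofrac_eq0 ?oner_eq0.
move=> a b.
have [da db] := (denom_ratioP (repr a), denom_ratioP (repr b)).
rewrite {1}[a]frac_repr {1}[b]frac_repr mulf_div -!tofracM.
by rewrite frac_map_div ?mulf_neq0 // !rmorphM -mulf_div.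
Qed.

End FracMap.

(* Coefficient fields.  Kqt is Q(q^{1/2}, t), with q := (q^{1/2})^2, and Kqts
   is the field of rational functions in s over it. *)
Definition Kqt : fieldType := {fraction {mpoly rat[2]}}.
Definition Kqts : fieldType := {fraction {poly Kqt}}.

Definition sqrtq0 : Kqt := ('X_(inord 0) : {mpoly rat[2]})%:F.
Definition t0 : Kqt := ('X_(inord 1) : {mpoly rat[2]})%:F.

Definition sqrtq : Kqts := (sqrtq0%:P)%:F.
Definition q : Kqts := sqrtq ^+ 2.
Definition t : Kqts := (t0%:P)%:F.
Definition s : Kqts := ('X : {poly Kqt})%:F.

(* The substitution s |-> s q^{1/2} in Kqts *)
Definition shift_poly : {poly Kqt} -> {poly Kqt} := comp_poly (sqrtq0 *: 'X).
HB.instance Definition _ := GRing.RMorphism.on shift_poly.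

Lemma shift_poly_inj p : shift_poly p = 0 -> p = 0.
Proof.
have r0 : sqrtq0 != 0.
  rewrite tofrac_eq0 -msupp_eq0 msuppX //.
move=> /(congr1 (comp_poly (sqrtq0^-1 *: 'X))).
rewrite /shift_poly -comp_polyA linearZ /= comp_polyX scalerA mulfV // scale1r.
by rewrite comp_polyXr comp_poly0.
Qed.

Definition shift_s : Kqts -> Kqts := frac_map shift_poly.

HB.instance Definition _ := GRing.isZmodMorphism.Build Kqts Kqts shift_s
  (frac_map_zmod_morphism shift_poly_inj).
HB.instance Definition _ := GRing.isMonoidMorphism.Build Kqts Kqts shift_s
  (frac_map_monoid_morphism shift_poly_inj).

Lemma shift_s_poly (p : {poly Kqt}) : shift_s (p%:F) = (shift_poly p)%:F.
Proof.
rewrite /shift_s -[p%:F]divr1 -tofrac1.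
rewrite (frac_map_div shift_poly_inj) ?oner_neq0 //.
by rewrite rmorph1 tofrac1 divr1.
Qed.

Lemma shift_s_const (c : Kqt) : shift_s (c%:P)%:F = (c%:P)%:F.
Proof. by rewrite shift_s_poly /shift_poly comp_polyC. Qed.

Lemma shift_s_s : shift_s s = s * sqrtq.
Proof.
by rewrite shift_s_poly /shift_poly comp_polyX -mul_polyC tofracM mulrC.
Qed.

(* A partition with at most n parts is a nonincreasing n-tuple, padded by 0. *)
Definition is_part (n : nat) (lam : n.-tuple nat) : bool := sorted geq lam.

Definition dominated (n : nat) (mu lam : n.-tuple nat) : Prop :=
  forall k : nat, (1 <= k)%N -> (sumn (take k mu) <= sumn (take k lam))%N.

Definition sdominated (n : nat) (mu lam : n.-tuple nat) : Prop :=
  dominated mu lam /\ mu <> lam.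

(* Laurent polynomials in n variables: finitely supported functions on the
   exponents Z^n. *)
Definition expo (n : nat) := {ffun 'I_n -> int}.
Definition laurent (K : fieldType) (n : nat) := {malg K[expo n]}.

Definition part_expo (n : nat) (lam : n.-tuple nat) : expo n :=
  [ffun i => (tnth lam i)%:Z].

(* BC_n is the set of pairs of a permutation and a family of signs
   sg i b = (-1)^b, acting on exponents. *)
Definition sg (b : bool) : int := (-1) ^+ b.

Definition bc_act (n : nat) (w : 'S_n * {ffun 'I_n -> bool}) (a : expo n) :
    expo n :=
  [ffun i => sg (w.2 i) * a (w.1 i)].

Definition bc_orbit (n : nat) (a : expo n) : seq (expo n) :=
  undup [seq bc_act w a | w : 'S_n * {ffun 'I_n -> bool}].

Definition bc_symmetric (K : fieldType) (n : nat) (P : laurent K n) : Prop :=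
  forall (w : 'S_n * {ffun 'I_n -> bool}) (a : expo n),
    monalg.mcoeff (bc_act w a) P = monalg.mcoeff a P.

Definition m_orbit (K : fieldType) (n : nat) (lam : n.-tuple nat) :
    laurent K n :=
  \sum_(a <- bc_orbit (part_expo lam)) monalg.mkmalgU a 1.

(* Value of P at x in L^n, its coefficients being mapped to L by f *)
Definition leval (K L : fieldType) (f : K -> L) (n : nat) (P : laurent K n)
    (x : 'I_n -> L) : L :=
  monalg.mmap f (fun a : expo n => \prod_(i < n) x i ^ a i) P.

(* The point x_i = q^{mu_i} t^{n-i} s; the indices here start from 0. *)
Definition interp_point (n : nat) (mu : n.-tuple nat) (i : 'I_n) : Kqts :=
  q ^+ tnth mu i * t ^+ (n - i.+1) * s.

(* P is the interpolation polynomial of index lam at the parameters q, t, s *)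
Definition is_interpolation (n : nat) (P : laurent Kqts n)
    (lam : n.-tuple nat) : Prop :=
  [/\ bc_symmetric P,
      exists (r : seq (n.-tuple nat)) (c : n.-tuple nat -> Kqts),
        (forall mu, mu \in r -> is_part mu /\ sdominated mu lam) /\
        P = m_orbit Kqts lam + \sum_(mu <- r) c mu *: m_orbit Kqts mu
    & forall mu : n.-tuple nat, is_part mu -> sdominated mu lam ->
        leval id P (interp_point mu) = 0].

Definition ratfun (L : fieldType) (n : nat) : fieldType :=
  {fraction {mpoly L[n]}}.
Definition rf_const (L : fieldType) (n : nat) (c : L) : ratfun L n :=
  (c%:MP_[n])%:F.
Definition rf_var (L : fieldType) (n : nat) (i : 'I_n) : ratfun L n :=
  ('X_i : {mpoly L[n]})%:F.

(* Main.v *)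
From HB Require Import structures.
From mathcomp Require Import all_boot all_order all_algebra all_fingroup.
From mathcomp Require Import finmap.
From mathcomp Require Import monalg.
From mathcomp Require Import zify ring.
From mathcomp Require Import mpoly.
Require Import Defs.

Set Implicit Arguments.
Unset Strict Implicit.
Unset Printing Implicit Defensive.

Import Order.TTheory GRing.Theory Num.Theory.
Local Open Scope ring_scope.

(** Both sides are compared after multiplication by the type C Weyl denominator
    Delta = prod_i (x_i - 1/x_i) prod_(i<j) (z_i - z_j), where z_i = x_i + 1/x_i.
    Multiplied by Delta, the right-hand side loses its denominators: with
    y = x^sigma the summand of sigma becomes sgn(sigma) N(y), where N(y) is
        prod_i (- 1/y_i + (s + u/s) - u y_i) prod_(i<j) (g_i - g_j)
    times the value of P at q^(1/2) y with s replaced by s q^(1/2), and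
    g_i = 1/y_i + t y_i ([weyl_den_ratio]).  Let G be Delta times the
    difference of the two sides.  It is a Laurent polynomial with four
    properties.

    - It is antisymmetric under BC_n: the prefactor of N is symmetric times a
      Vandermonde product, so that permutations act by their sign, and
      summation against sgn(sigma) takes care of the inversions
      ([flip_sum_bc]).
    - Its exponents are dominated by lam + rho, with rho = (n, ..., 1), because
      every factor of N and of Delta has a single dominant exponent
      ([has_top]).
    - Its coefficient at lam + rho is zero: the dominant coefficients of the
      factors multiply, and their sum over sigma factors over i into the
      eigenvalue on the left-hand side ([op_num_top]).
    - It vanishes at the point of every partition nu < lam.  On the left
      P does.  On the right the summand of sigma is zero unless lowering nu_i
      by 1 wherever sigma_i = -1 gives a partition mu; then the shifted
      argument is the point of mu, up to the substitution s -> s q^(1/2), and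
      P vanishes there because mu <= nu < lam ([op_num_vanish]).

    Hence G is a combination of the alternants a_(nu + rho), nu < lam, and it
    vanishes at the points of these same nu.  The square matrix of the values
    of the a_(mu + rho) at the points of nu is invertible ([interp_unitmx]),
    so that G = 0.  Indeed, at t = s = q the point of nu becomes q^(nu + rho)
    and the leading power of q in the entry (mu, nu) is the scalar product
    <mu + rho, nu + rho>; the inequality 2 <a, b> <= |a|^2 + |b|^2, strict for
    a <> b, makes the diagonal prevail. *)

(** * The dominance order on exponents *)

Section Dominance.
Variable n : nat.
Implicit Types a b c : expo n.

Lemma expoD a b i : (a + b) i = a i + b i.
Proof. by rewrite ffunE. Qed.

Definition dom_le a b : Prop :=
  forall k : nat, \sum_(i < n | (i < k)%N) a i <= \sum_(i < n | (i < k)%N) b i.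

Lemma dom_le_refl a : dom_le a a. Proof. by move=> k. Qed.

Lemma dom_le_trans a b c : dom_le a b -> dom_le b c -> dom_le a c.
Proof. by move=> ab bc k; apply: le_trans (ab k) (bc k). Qed.

Lemma dom_le_add a b a' b' : dom_le a b -> dom_le a' b' -> dom_le (a + a') (b + b').
Proof.
move=> ab ab' k; rewrite !(eq_bigr _ (fun i _ => expoD _ _ i)) !big_split /=.
exact: lerD.
Qed.

Lemma dom_le_antisym a b : dom_le a b -> dom_le b a -> a = b.
Proof.
move=> ab ba; have E k : \sum_(i < n | (i < k)%N) a i = \sum_(i < n | (i < k)%N) b i.
  by apply/eqP; rewrite eq_le ab ba.
apply/ffunP => i; have := E i.+1.
rewrite (bigD1 i) //= [RHS](bigD1 i) //=.
have eqP (j : 'I_n) : (j < i.+1)%N && (j != i) = (j < i)%N by rewrite -val_eqE /=; lia.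
rewrite !(eq_bigl _ _ eqP) E; exact: addIr.
Qed.

(** Extremality: a sum reaches the top only if both summands do. This makes
    dominant coefficients multiplicative. *)
Lemma dom_le_add_eq a b a' b' :
  dom_le a b -> dom_le a' b' -> a + a' = b + b' -> a = b /\ a' = b'.
Proof.
move=> ab ab' E; have Eab : a = b.
  apply: dom_le_antisym => // k.
  have := congr1 (fun c : expo n => \sum_(i < n | (i < k)%N) c i) E.
  rewrite /= !(eq_bigr _ (fun i _ => expoD _ _ i)) !big_split /= => Ek.
  by rewrite -(lerD2r (\sum_(i < n | (i < k)%N) b' i)) -Ek lerD2l; apply: ab'.
by split=> //; move: E; rewrite Eab; apply: addrI.
Qed.

(** The rearrangement inequality. With c = mu_k (parts counted from 0), the sum of
    the mu_(w i) - c over i < k is at most the sum of the positive parts of all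
    mu_i - c, and these are carried by the first k indices. This is why the
    truncated subtraction of natural numbers appears in the proof. *)
Lemma dom_le_bc_act (w : 'S_n * {ffun 'I_n -> bool}) (mu : n.-tuple nat) :
  is_part mu -> dom_le (bc_act w (part_expo mu)) (part_expo mu).
Proof.
move=> pmu k; apply: (@le_trans _ _ (\sum_(i < n | (i < k)%N) (tnth mu (w.1 i))%:Z)).
  apply: ler_sum => i _; rewrite !ffunE /sg; case: (w.2 i); rewrite ?expr0 ?expr1; lia.
under [X in _ <= X]eq_bigr do rewrite ffunE.
rewrite -!(big_morph Posz PoszD (erefl _)).
rewrite lez_nat.
have mono i j : (i <= j)%N -> (j < n)%N -> (nth 0%N mu j <= nth 0%N mu i)%N.
  have tr : transitive geq by move=> x y z /= yx xz; apply: leq_trans xz yx.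
  move=> ij jn; apply: (sorted_leq_nth tr (fun x => leqnn x) 0%N pmu i j) => //.
  all: rewrite ?inE ?size_tuple; try lia.
have [kn|nk] := leqP n k.
  have allk (i : 'I_n) : (i < k)%N = xpredT i by rewrite (leq_trans (ltn_ord i)).
  by rewrite !(eq_bigl _ _ allk) [leqRHS](reindex_inj (@perm_inj _ w.1)).
(* mu_i >= c for i < k and mu_i <= c for the other i *)
pose c := nth 0%N mu k.
apply: (@leq_trans (\sum_(i < n | (i < k)%N) ((tnth mu (w.1 i) - c) + c))%N).
  by apply: leq_sum => i _; lia.
rewrite big_split /=.
apply: (@leq_trans (\sum_(i < n) (tnth mu (w.1 i) - c) + \sum_(i < n | (i < k)%N) c)%N).
  by rewrite leq_add2r [leqRHS](bigID (fun i : 'I_n => (i < k)%N)) /= leq_addr.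
rewrite -(reindex_inj (P := xpredT) (F := fun i => (tnth mu i - c)%N) (@perm_inj _ w.1)).
rewrite (bigID (fun i : 'I_n => (i < k)%N)) /= [X in (_ + X + _)%N]big1 ?addn0; last first.
  move=> i /=; rewrite -leqNgt => ki; apply/eqP; rewrite subn_eq0 (tnth_nth 0%N) mono //.
rewrite -big_split /=; apply: eq_leq; apply: eq_bigr => i ik.
by rewrite subnK // (tnth_nth 0%N) mono // ltnW.
Qed.

End Dominance.

(** * Laurent expressions and their values *)

Section Monomials.
Variables (n : nat) (K : fieldType).
Implicit Types (y : 'I_n -> K) (a b : expo n) (w : 'S_n * {ffun 'I_n -> bool}).

Definition monom y a : K := \prod_(i < n) y i ^ a i.

Lemma monom0 y : monom y 0 = 1.
Proof. by rewrite /monom big1 // => i _; rewrite ffunE expr0z. Qed.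

Lemma monomD y a b : (forall i, y i != 0) ->
  monom y (a + b) = monom y a * monom y b.
Proof.
move=> y0; rewrite /monom -big_split /=; apply: eq_bigr => i _.
by rewrite ffunE expfzDr.
Qed.

(** The action on points that is dual to [bc_act] on exponents. *)
Definition bc_point w y : 'I_n -> K :=
  fun j => y ((w.1^-1)%g j) ^ sg (w.2 ((w.1^-1)%g j)).

Lemma bc_point_neq0 w y : (forall i, y i != 0) -> forall i, bc_point w y i != 0.
Proof. by move=> y0 i; rewrite expfz_neq0. Qed.

Lemma monom_bc w y a : monom (bc_point w y) a = monom y (bc_act w a).
Proof.
rewrite /monom (reindex_inj (@perm_inj _ w.1)); apply: eq_bigr => i _.
by rewrite /bc_point permK ffunE exprzAC exprz_exp mulrC.
Qed.

End Monomials.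

(** The sign character of BC_n for which the type C Weyl denominator is
    antisymmetric. *)
Definition bc_sign (R : comNzRingType) n (w : 'S_n * {ffun 'I_n -> bool}) : R :=
  (-1) ^+ w.1 * \prod_(i < n) (-1) ^+ w.2 i.

Lemma rmorph_bc_sign (R R' : comNzRingType) (f : {rmorphism R -> R'}) n
    (w : 'S_n * {ffun 'I_n -> bool}) : f (bc_sign R w) = bc_sign R' w.
Proof.
rewrite rmorphM rmorph_prod rmorph_sign; congr (_ * _).
by apply: eq_bigr => i _; rewrite rmorph_sign.
Qed.

Lemma bc_sign_sqr (R : comNzRingType) n (w : 'S_n * {ffun 'I_n -> bool}) :
  bc_sign R w * bc_sign R w = 1.
Proof.
rewrite mulrACA -expr2 sqrr_sign mul1r -big_split /= big1 // => i _.
by rewrite -expr2 sqrr_sign.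
Qed.

Lemma bc_act_inj n (w : 'S_n * {ffun 'I_n -> bool}) : injective (bc_act w).
Proof.
move=> a b /ffunP E; apply/ffunP => i; have := E ((w.1^-1)%g i).
rewrite !ffunE permKV; apply: mulfI.
by rewrite /sg; case: (w.2 _).
Qed.

Section Expressions.
Variables (L : fieldType) (n : nat).
Implicit Types (a b : expo n) (e : seq (L * expo n)).

(** A list of terms that need not be in normal form: an exponent may be repeated,
    so that sums and products are plain list operations. The Laurent polynomial
    that a list stands for is its function [coef]. *)
Definition lexpr := seq (L * expo n).
Definition coef e a : L := \sum_(p <- e | p.2 == a) p.1.
Definition lone : lexpr := [:: (1, 0)].
Definition lmul e1 e2 : lexpr := [seq (p1.1 * p2.1, p1.2 + p2.2) | p1 <- e1, p2 <- e2].
Definition lscale (c : L) e : lexpr := [seq (c * p.1, p.2) | p <- e].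

Lemma coef_cat e1 e2 a : coef (e1 ++ e2) a = coef e1 a + coef e2 a.
Proof. by rewrite /coef big_cat. Qed.

Lemma coef_scale c e a : coef (lscale c e) a = c * coef e a.
Proof. by rewrite /coef big_map mulr_sumr. Qed.

Lemma coef_map_bc w e a :
  coef [seq (p.1, bc_act w p.2) | p <- e] (bc_act w a) = coef e a.
Proof.
by rewrite /coef big_map; apply: eq_bigl => p; rewrite (inj_eq (@bc_act_inj _ w)).
Qed.

Lemma coef_out e a : a \notin map snd e -> coef e a = 0.
Proof.
move=> ae; rewrite /coef big_seq_cond big1 // => p /andP[pe /eqP pa].
by case/negP: ae; rewrite -pa map_f.
Qed.

(** An upper bound b for the exponents, together with the coefficient at b
    (possibly 0). *)
Definition has_top e b (c : L) : Prop :=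
  (forall p, p \in e -> dom_le p.2 b) /\ coef e b = c.

Lemma has_top_one : has_top lone 0 1.
Proof.
split; first by move=> p; rewrite inE => /eqP ->; apply: dom_le_refl.
by rewrite /coef big_mkcond big_seq1 eqxx.
Qed.

(** By [dom_le_add_eq] only the pair of the two top terms contributes to the
    coefficient at b1 + b2. *)
Lemma has_top_mul e1 e2 b1 b2 c1 c2 :
  has_top e1 b1 c1 -> has_top e2 b2 c2 ->
  has_top (lmul e1 e2) (b1 + b2) (c1 * c2).
Proof.
move=> [le1 <-] [le2 <-]; split=> [p /allpairsP[[p1 p2] [/= p1e p2e ->]]|].
  by apply: dom_le_add; [apply: le1 | apply: le2].
rewrite /coef [LHS]big_mkcond big_allpairs_dep /= mulr_suml [RHS]big_mkcond /=.
apply: eq_big_seq => p1 p1e.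
have [pb1|pb1] := eqVneq p1.2 b1.
  rewrite mulr_sumr [RHS]big_mkcond; apply: eq_big_seq => p2 p2e /=.
  by rewrite pb1 (inj_eq (addrI _)).
rewrite big_seq big1 // => p2 p2e; case: eqP => // E.
have [E1 _] := dom_le_add_eq (le1 _ p1e) (le2 _ p2e) E.
by rewrite E1 eqxx in pb1.
Qed.

Lemma has_top_prod (I : Type) (r : seq I) (P : pred I) (F : I -> lexpr)
    (b : I -> expo n) (c : I -> L) :
  (forall i, P i -> has_top (F i) (b i) (c i)) ->
  has_top (\big[lmul/lone]_(i <- r | P i) F i)
    (\sum_(i <- r | P i) b i) (\prod_(i <- r | P i) c i).
Proof.
move=> H; apply: (big_rec3 has_top) => [|i e1 b1 c1 Pi]; first exact: has_top_one.
by move=> Hr; apply: has_top_mul; [apply: H | ].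
Qed.

Lemma has_top_scale e b c d : has_top e b c -> has_top (lscale d e) b (d * c).
Proof.
move=> [le1 <-]; split; last exact: coef_scale.
by move=> p /mapP[p1 p1e ->]; apply: (le1 p1).
Qed.

Lemma has_top_cat e1 e2 b c1 c2 :
  has_top e1 b c1 -> has_top e2 b c2 -> has_top (e1 ++ e2) b (c1 + c2).
Proof.
move=> [le1 <-] [le2 <-]; split; last exact: coef_cat.
by move=> p; rewrite mem_cat => /orP[]; [apply: le1 | apply: le2].
Qed.

Lemma has_top_nil b : has_top [::] b 0.
Proof. by split=> //; rewrite /coef big_nil. Qed.

Lemma has_top_sum (I : Type) (r : seq I) (P : pred I) (F : I -> lexpr) b
    (c : I -> L) :
  (forall i, P i -> has_top (F i) b (c i)) ->
  has_top (\big[cat/[::]]_(i <- r | P i) F i) b (\sum_(i <- r | P i) c i).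
Proof.
move=> H; apply: (big_rec2 (fun e c => has_top e b c)); first exact: has_top_nil.
by move=> i e d Pi Hr; apply: has_top_cat; [apply: H | ].
Qed.

Section Evaluation.
Variables (K : fieldType) (f : {rmorphism L -> K}) (y : 'I_n -> K).

Definition ev e : K := \sum_(p <- e) f p.1 * monom y p.2.

Lemma ev_cat e1 e2 : ev (e1 ++ e2) = ev e1 + ev e2.
Proof. by rewrite /ev big_cat. Qed.

Lemma ev_scale c e : ev (lscale c e) = f c * ev e.
Proof.
by rewrite /ev big_map mulr_sumr; apply: eq_bigr => p _; rewrite rmorphM mulrA.
Qed.

Lemma ev_coef (r : seq (expo n)) e :
  uniq r -> (forall a, coef e a != 0 -> a \in r) ->
  ev e = \sum_(a <- r) f (coef e a) * monom y a.
Proof.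
move=> ur hr; pose r' := undup (map snd e).
have Er' : ev e = \sum_(a <- r') f (coef e a) * monom y a.
  transitivity (\sum_(a <- r') \sum_(p <- e | p.2 == a) f p.1 * monom y p.2).
    rewrite (exchange_big_dep xpredT) //=; apply: eq_big_seq => p pe.
    rewrite -big_filter; have -> : [seq i <- r' | p.2 == i] = [:: p.2].
      by rewrite (eq_filter (a2 := pred1 p.2)) ?filter_pred1_uniq ?undup_uniq ?mem_undup ?map_f // => a; rewrite eq_sym.
    by rewrite big_seq1.
  apply: eq_bigr => a _; rewrite rmorph_sum mulr_suml.
  by apply: eq_bigr => p /eqP ->.
rewrite Er' (bigID (fun a => coef e a != 0)) /= [X in _ + X]big1 ?addr0; last first.
  by move=> a /negbNE/eqP ->; rewrite rmorph0 mul0r.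
rewrite [RHS](bigID (fun a => coef e a != 0)) /= [X in _ = _ + X]big1 ?addr0; last first.
  by move=> a /negbNE/eqP ->; rewrite rmorph0 mul0r.
rewrite -big_filter -[RHS]big_filter; apply: perm_big; apply: uniq_perm.
- by rewrite filter_uniq ?undup_uniq.
- by rewrite filter_uniq.
move=> a; rewrite !mem_filter; have [//|ca] := eqVneq (coef e a) 0.
rewrite hr //= mem_undup; apply/idP; apply: contraR ca => /coef_out ->.
by rewrite eqxx.
Qed.

Hypothesis y0 : forall i, y i != 0.

Lemma ev_one : ev lone = 1.
Proof. by rewrite /ev big_seq1 rmorph1 monom0 mul1r. Qed.

Lemma ev_mul : {morph ev : e1 e2 / lmul e1 e2 >-> e1 * e2}.
Proof.
move=> e1 e2; rewrite /ev big_allpairs_dep mulr_suml; apply: eq_bigr => p1 _.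
rewrite mulr_sumr; apply: eq_bigr => p2 _.
by rewrite rmorphM monomD // mulrACA.
Qed.

Lemma ev_prod (I : Type) (r : seq I) (P : pred I) (F : I -> lexpr) :
  ev (\big[lmul/lone]_(i <- r | P i) F i) = \prod_(i <- r | P i) ev (F i).
Proof. exact: (big_morph ev ev_mul ev_one). Qed.

Lemma ev_sum (I : Type) (r : seq I) (P : pred I) (F : I -> lexpr) :
  ev (\big[cat/[::]]_(i <- r | P i) F i) = \sum_(i <- r | P i) ev (F i).
Proof. by apply: (big_morph ev ev_cat); rewrite /ev big_nil. Qed.

End Evaluation.

Lemma rf_const_is_rmorphism : zmod_morphism (@rf_const L n) * monoid_morphism (@rf_const L n).
Proof.
split; first by move=> a b; rewrite /rf_const mpoly.mpolyCB rmorphB.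
by split=> [|a b]; rewrite /rf_const ?mpoly.mpolyC1 ?mpoly.mpolyCM ?rmorph1 ?rmorphM.
Qed.

HB.instance Definition _ := GRing.isZmodMorphism.Build L (ratfun L n) (@rf_const L n)
  rf_const_is_rmorphism.1.
HB.instance Definition _ := GRing.isMonoidMorphism.Build L (ratfun L n) (@rf_const L n)
  rf_const_is_rmorphism.2.

Lemma rf_var_neq0 i : @rf_var L n i != 0.
Proof. by rewrite tofrac_eq0 -mpoly.msupp_eq0 mpoly.msuppX. Qed.

(** Multiplication by a high power of all variables turns the expression into a
    polynomial, whose coefficients can be read off. *)
Lemma ev_generic_eq0 e :
  ev (@rf_const L n) (@rf_var L n) e = 0 -> forall a, coef e a = 0.
Proof.
move=> E; pose r := undup (map snd e).
pose N : nat := \sum_(a <- r) \sum_(i < n) `|a i|%N.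
have leN a i : a \in r -> (`|a i|%N <= N)%N.
  move=> ar; rewrite /N (big_rem a) //= (bigD1 i) //=; lia.
pose m a : mpoly.multinom n := mpoly.Multinom [tuple absz (a i + N%:Z)%R | i < n].
have mE a i : a \in r -> (mpoly.fun_of_multinom (m a) i)%:Z = a i + N%:Z.
  by move=> ar; rewrite mpoly.multinomE tnth_mktuple; have := leN _ i ar; lia.
pose p : mpoly.mpoly n L := \sum_(a <- r) coef e a *: mpoly.mpolyX L (m a).
have p0 : p = 0.
  apply/eqP; rewrite -tofrac_eq0; apply/eqP.
  transitivity (ev (@rf_const L n) (@rf_var L n) e * \prod_(i < n) @rf_var L n i ^ N%:Z); last first.
    by rewrite E mul0r.
  rewrite (@ev_coef _ _ _ r) ?undup_uniq //; last first.
    by move=> a; apply: contraR; rewrite mem_undup => /coef_out ->.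
  rewrite /p rmorph_sum mulr_suml; apply: eq_big_seq => a ar.
  rewrite -mpoly.mul_mpolyC rmorphM -mulrA; congr (_ * _).
  rewrite mpoly.mpolyXE_id rmorph_prod -big_split /=; apply: eq_bigr => i _.
  by rewrite rmorphXn -expfzDr ?rf_var_neq0 // -mE.
move=> a; have [ar|ar] := boolP (a \in r); last first.
  by apply: coef_out; rewrite -mem_undup.
have := congr1 (mpoly.mcoeff (m a)) p0.
rewrite /p mpoly.mcoeff0 raddf_sum (bigD1_seq a) ?undup_uniq //=.
rewrite mpoly.mcoeffZ mpoly.mcoeffX eqxx mulr1 big_seq_cond big1 ?addr0 // => b.
move=> /andP[br ba]; rewrite mpoly.mcoeffZ mpoly.mcoeffX; case: eqP => [E1|_]; last by rewrite mulr0.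
case/eqP: ba; apply/ffunP => i; have := mE _ i br; rewrite E1 mE //.
by move/addIr.
Qed.
End Expressions.

(** * Antisymmetric expressions and alternants *)

Lemma bc_actE n (w : 'S_n * {ffun 'I_n -> bool}) (a : expo n) i :
  bc_act w a i = sg (w.2 i) * a (w.1 i).
Proof. by rewrite ffunE. Qed.

Section Strict.
Variable n : nat.
Implicit Types (mu nu : n.-tuple nat) (a : expo n) (w : 'S_n * {ffun 'I_n -> bool}).

Lemma is_part_le mu (i j : 'I_n) : is_part mu -> (i <= j)%N -> (tnth mu j <= tnth mu i)%N.
Proof.
have tr : transitive geq by move=> x y z /= yx xz; apply: leq_trans xz yx.
move=> pmu ij; rewrite !(tnth_nth 0%N).
by apply: (sorted_leq_nth tr (fun x => leqnn x) 0%N pmu i j) => //; rewrite inE size_tuple.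
Qed.

Lemma is_part_intro mu :
  (forall i j : 'I_n, j = i.+1 :> nat -> (tnth mu j <= tnth mu i)%N) -> is_part mu.
Proof.
move=> H; apply/(sortedP 0%N) => i; rewrite size_tuple => lti /=.
by have := H (Ordinal (ltnW lti)) (Ordinal lti) erefl; rewrite !(tnth_nth 0%N).
Qed.

Definition rho_shift mu : n.-tuple nat := [tuple (tnth mu i + (n - i))%N | i < n].

(** The exponent mu + rho, rho = (n, ..., 1). Partitions correspond in this way to
    the strictly decreasing positive exponents, the regular dominant ones. *)
Definition rho_expo mu : expo n := part_expo (rho_shift mu).

Lemma rho_expoE mu i : rho_expo mu i = (tnth mu i + (n - i))%:Z.
Proof. by rewrite ffunE tnth_mktuple. Qed.

Lemma is_part_rho_shift mu : is_part mu -> is_part (rho_shift mu).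
Proof.
move=> pmu; apply: is_part_intro => i j ji; rewrite !tnth_mktuple.
by have := is_part_le pmu (leq_trans (leqnSn i) (eq_leq (esym ji))); lia.
Qed.

Lemma rho_expo_inj : injective rho_expo.
Proof.
move=> mu nu /ffunP E; apply: eq_from_tnth => i.
have := E i; rewrite !rho_expoE; lia.
Qed.

Lemma rho_expo_lt mu (i j : 'I_n) : is_part mu -> (i < j)%N -> rho_expo mu j < rho_expo mu i.
Proof.
move=> pmu ij; rewrite !rho_expoE; have := is_part_le pmu (ltnW ij).
have := ltn_ord j; lia.
Qed.

Lemma rho_expo_gt0 mu i : 0 < rho_expo mu i.
Proof. rewrite rho_expoE; have := ltn_ord i; lia. Qed.

(** Absolute values determine w mu up to order; two dominant rearrangements of
    each other dominate one another, hence agree, and regularity recovers w. *)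
Lemma bc_act_rho_expo_inj w w' mu nu : is_part mu -> is_part nu ->
  bc_act w (rho_expo mu) = bc_act w' (rho_expo nu) -> w = w' /\ mu = nu.
Proof.
move=> pmu pnu E.
have Eabs i : rho_expo mu (w.1 i) = rho_expo nu (w'.1 i).
  have := congr1 (fun a : expo n => `|a i|) E; rewrite /= !bc_actE !normrM /sg !normrX normrN1 !expr1n !mul1r.
  by rewrite !gtr0_norm ?rho_expo_gt0.
have Emn : rho_expo mu = rho_expo nu.
  apply: dom_le_antisym.
    rewrite (_ : rho_expo mu = bc_act ((w.1^-1 * w'.1)%g, [ffun=> false]) (rho_expo nu)).
      exact: dom_le_bc_act (is_part_rho_shift pnu).
    by apply/ffunP => i; rewrite bc_actE /= permM (ffunE (fun=> false)) /sg expr0 mul1r -Eabs permKV.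
  rewrite (_ : rho_expo nu = bc_act ((w'.1^-1 * w.1)%g, [ffun=> false]) (rho_expo mu)).
    exact: dom_le_bc_act (is_part_rho_shift pmu).
  by apply/ffunP => i; rewrite bc_actE /= permM (ffunE (fun=> false)) /sg expr0 mul1r Eabs permKV.
split; last exact: rho_expo_inj.
have Ew : w.1 = w'.1.
  apply/permP => i; have := Eabs i; rewrite -Emn => Ei.
  by case: (ltngtP (w.1 i) (w'.1 i)) => [/(rho_expo_lt pmu)|/(rho_expo_lt pmu)|/val_inj //];
     rewrite Ei ltxx.
case: w w' E {Eabs} Ew => [p e] [p' e'] /= E Ep; rewrite -Ep in E *; congr (_, _).
apply/ffunP => i; have := congr1 (fun a : expo n => a i) E.
rewrite /= !bc_actE -Emn /=; have := rho_expo_gt0 mu (p i).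
by rewrite /sg; case: (e i); case: (e' i) => //; rewrite ?expr0 ?expr1; lia.
Qed.

(** Sorting the absolute values brings a to dominant form, and n distinct
    positive integers in decreasing order are at least (n, ..., 1). *)
Lemma bc_regular_dominant a : (forall i, a i != 0) ->
  (forall i j, i != j -> `|a i|%N != `|a j|%N) ->
  exists w nu, is_part nu /\ a = bc_act w (rho_expo nu).
Proof.
move=> a0 aI; pose t := [tuple absz (a i) | i < n].
pose s := sort geq t.
have [p Ep] : exists p : 'S_n, s = [tuple tnth t (p i) | i < n] :> seq nat.
  by apply/tuple_permP; rewrite perm_sort.
have tot : total geq by move=> x y; apply: leq_total.
have := sort_sorted tot t; rewrite -/s Ep => psort.
set s' := [tuple tnth t (p i) | i < n] in psort Ep.
have s'E i : tnth s' i = absz (a (p i)) by rewrite !tnth_mktuple.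
have s'lt (i j : 'I_n) : (i < j)%N -> (tnth s' j < tnth s' i)%N.
  move=> ij; rewrite ltn_neqAle is_part_le ?(ltnW ij) // andbT !s'E aI //.
  by rewrite (inj_eq perm_inj) -val_eqE /= gtn_eqF.
have s'n k : forall i : 'I_n, (n - i = k.+1)%N -> (k.+1 <= tnth s' i)%N.
  elim: k => [|k IH] i ik; first by rewrite s'E lt0n absz_eq0.
  have lti : (i.+1 < n)%N by lia.
  apply: leq_trans (s'lt i (Ordinal lti) (leqnn _)).
  by rewrite ltnS IH //=; lia.
pose nu := [tuple (tnth s' i - (n - i))%N | i < n].
have Es' i : rho_expo nu i = (tnth s' i)%:Z.
  have ni : (0 < n - i)%N by rewrite subn_gt0.
  rewrite rho_expoE tnth_mktuple; have := s'n _ i (esym (prednK ni)); lia.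
exists ((p^-1)%g, [ffun i => a i < 0]), nu; split.
  apply: is_part_intro => i j ji; rewrite !tnth_mktuple.
  have := s'lt i j (eq_leq (esym ji)); have := ltn_ord j; rewrite !s'E; lia.
apply/ffunP => i; rewrite ffunE /= Es' s'E permKV ffunE /sg.
case: ltP => _ai; rewrite ?expr0 ?expr1; lia.
Qed.
End Strict.

(** The determinant of the y_i ^ k_j - y_i ^ (- k_j) with k = nu + rho, expanded
    over BC_n. *)
Definition alternant n (K : fieldType) (y : 'I_n -> K) (nu : n.-tuple nat) : K :=
  \sum_(w : 'S_n * {ffun 'I_n -> bool}) bc_sign K w * monom y (bc_act w (rho_expo nu)).

Section Antisymmetric.
Variables (L : fieldType) (n : nat).
Hypothesis char2 : (1 + 1 : L) != 0.
Variable e : seq (L * expo n).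
Hypothesis anti : forall w a, coef e (bc_act w a) = bc_sign L w * coef e a.

Lemma anti_fixed w a : bc_act w a = a -> bc_sign L w = -1 -> coef e a = 0.
Proof.
move=> wa ws; have := anti w a; rewrite wa ws mulN1r => E.
have : (1 + 1) * coef e a = 0 by rewrite mulrDl mul1r {1}E addNr.
by move/eqP; rewrite mulf_eq0 (negbTE char2) => /eqP.
Qed.

(** If some a_i is 0, or two entries agree up to sign, then an element of sign -1
    fixes a, which kills the coefficient. *)
Lemma anti_support a : coef e a != 0 -> exists w nu, is_part nu /\ a = bc_act w (rho_expo nu).
Proof.
move=> ca; apply: bc_regular_dominant => [i|i j ij].
  apply: contraNneq ca => ai; apply/eqP.
  apply: (@anti_fixed (1%g, [ffun k => k == i])).
    by apply/ffunP => k; rewrite !ffunE perm1; case: eqP => [->|_]; rewrite ?ai ?mulr0 ?mul1r.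
  rewrite /bc_sign odd_perm1 expr0 mul1r (bigD1 i) //= ffunE eqxx expr1 big1 ?mulr1 //.
  by move=> k /negbTE ki; rewrite ffunE ki.
apply: contraNneq ca => aij; apply/eqP.
pose b := a i != a j.
apply: (@anti_fixed (tperm i j, [ffun k => b && ((k == i) || (k == j))])).
  apply/ffunP => k; rewrite !ffunE /= /b.
  case: tpermP => [->|->|/eqP/negbTE -> /eqP/negbTE ->]; rewrite ?eqxx ?orbT ?andbT ?andbF ?mul1r //.
    by rewrite /sg; case: eqP => E; rewrite ?expr0 ?expr1; lia.
  by rewrite /sg; case: eqP => E; rewrite ?expr0 ?expr1; lia.
rewrite /bc_sign odd_tperm ij expr1 (bigD1 i) //= (bigD1 j) 1?eq_sym //= !ffunE !eqxx orbT andbT.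
rewrite big1 ?mulr1; first by rewrite -expr2 sqrr_sign mulr1.
by move=> k /andP[/negbTE ki /negbTE kj]; rewrite ffunE ki kj andbF.
Qed.

(** Each orbit that meets the support has exactly one representative nu + rho,
    with trivial stabilizer, so that the terms group into alternants. *)
Lemma ev_alternant (K : fieldType) (f : {rmorphism L -> K}) (y : 'I_n -> K)
    (S : seq (n.-tuple nat)) :
  uniq S -> (forall nu, nu \in S -> is_part nu) ->
  (forall nu, is_part nu -> coef e (rho_expo nu) != 0 -> nu \in S) ->
  ev f y e = \sum_(nu <- S) f (coef e (rho_expo nu)) * alternant y nu.
Proof.
move=> uS pS hS.
pose r := [seq bc_act w (rho_expo nu) | nu <- S, w <- enum {: 'S_n * {ffun 'I_n -> bool}}].
rewrite (@ev_coef _ _ _ _ _ r).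
- rewrite big_allpairs_dep /=; apply: eq_bigr => nu _.
  rewrite mulr_sumr big_enum /=; apply: eq_bigr => w _.
  by rewrite anti rmorphM rmorph_bc_sign [_ * f _]mulrC -!mulrA.
- apply: allpairs_uniq => //; first exact: enum_uniq.
  move=> [nu w] [nu' w'] /allpairsP[[x x'] /= [xS _ [-> ->]]] /allpairsP[[z z'] /= [zS _ [-> ->]]].
  by move=> /(bc_act_rho_expo_inj (pS _ xS) (pS _ zS)) [-> ->].
move=> a ca; have [w [nu [pnu Ea]]] := anti_support ca.
apply/allpairsP; exists (nu, w); split=> //=; last by rewrite mem_enum.
apply: hS => //; apply: contraNneq ca => c0.
by rewrite Ea anti c0 mulr0.
Qed.
End Antisymmetric.

(** * Alternants at powers of one variable *)

Section Dot.
Variable n : nat.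
Implicit Types (a b : expo n) (w : 'S_n * {ffun 'I_n -> bool}).

Definition dot a b : int := \sum_(i < n) a i * b i.

(** This is |a - b|^2 > 0. *)
Lemma dot_lt a b : a != b -> 2 * dot a b < dot a a + dot b b.
Proof.
move=> ab; rewrite -subr_gt0.
have -> : dot a a + dot b b - 2 * dot a b = \sum_(i < n) (a i - b i) ^+ 2.
  rewrite mulr_sumr -big_split -sumrB /=; apply: eq_bigr => i _; ring.
have [i abi] : exists i, a i != b i.
  apply/existsP; apply: contraR ab => /existsPn H; apply/eqP/ffunP => i.
  by have := H i; rewrite negbK => /eqP.
rewrite (bigD1 i) //= ltr_pwDl ?sumr_ge0 //; last by move=> j _; rewrite sqr_ge0.
by rewrite lt_def sqr_ge0 sqrf_eq0 subr_eq0 abi.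
Qed.

Lemma dot_ge0 a : 0 <= dot a a.
Proof. by apply: sumr_ge0 => l _; rewrite -expr2 sqr_ge0. Qed.

Lemma dot_bc w a : dot (bc_act w a) (bc_act w a) = dot a a.
Proof.
rewrite /dot [RHS](reindex_inj (@perm_inj _ w.1)); apply: eq_bigr => i _.
by rewrite bc_actE mulrACA /sg -expr2 sqrr_sign mul1r.
Qed.
End Dot.

Section Shifted.
Variables (n B : nat).

(** The alternant times the B-th power of each variable: for large B no negative
    exponent remains, and the formula makes sense in any commutative ring. *)
Definition alternantB (R : comNzRingType) (y : 'I_n -> R) (nu : n.-tuple nat) : R :=
  \sum_(w : 'S_n * {ffun 'I_n -> bool})
    bc_sign R w * \prod_(i < n) y i ^+ absz (B%:Z + bc_act w (rho_expo nu) i)%R.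

Lemma rmorph_alternantB (R R' : comNzRingType) (f : {rmorphism R -> R'}) y nu :
  f (alternantB y nu) = alternantB (f \o y) nu.
Proof.
rewrite rmorph_sum; apply: eq_bigr => w _; rewrite rmorphM rmorph_bc_sign rmorph_prod.
by congr (_ * _); apply: eq_bigr => i _; rewrite rmorphXn.
Qed.

Lemma rho_expo_bound w (nu : n.-tuple nat) (i : 'I_n) : (sumn nu + n <= B)%N ->
  0 <= B%:Z + bc_act w (rho_expo nu) i.
Proof.
move=> hB; rewrite bc_actE rho_expoE.
have : (tnth nu (w.1 i) <= sumn nu)%N.
  by rewrite sumnE big_tuple (bigD1 (w.1 i)) //= leq_addr.
rewrite /sg; case: (w.2 i); rewrite ?expr0 ?expr1; lia.
Qed.

Lemma alternantB_alternant (K : fieldType) (y : 'I_n -> K) (nu : n.-tuple nat) :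
  (forall i, y i != 0) -> (sumn nu + n <= B)%N ->
  alternantB y nu = (\prod_(i < n) y i ^+ B) * alternant y nu.
Proof.
move=> y0 hB; rewrite mulr_sumr; apply: eq_bigr => w _.
rewrite mulrCA; congr (_ * _); rewrite -big_split /=; apply: eq_bigr => i _.
have := rho_expo_bound w i hB; move: (bc_act w _ i) => z hz.
by rewrite !exprnP gez0_abs // expfzDr.
Qed.
End Shifted.

Section Principal.
Variables (n B N : nat) (S : N.-tuple (n.-tuple nat)).
Hypotheses (S_uniq : uniq S) (S_part : forall i, is_part (tnth S i)).
Hypothesis S_bound : forall i, (sumn (tnth S i) + n <= B)%N.

(** The valuation argument. Suppose that the combination v of the rows is zero,
    and choose i0 with v_i0 nonzero and deg v_i + |k_i|^2 maximal at i0, where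
    k_i = S_i + rho. In column i0 the term of i and w has degree
    deg v_i + 2 <w k_i, k_i0> up to a constant, which [dot_lt] bounds by
    deg v_i + |k_i|^2 + |k_i0|^2, strictly unless w k_i = k_i0. So one single term
    reaches the top degree and nothing cancels it. *)
Lemma det_principal_neq0 :
  \det (\matrix_(i < N, j < N)
     alternantB B (fun k => 'X ^+ (2 * absz (rho_expo (tnth S j) k)) : {poly rat}) (tnth S i)) != 0.
Proof.
apply/det0P => -[v /rV0Pn[i1 vi1] vM].
pose k i := rho_expo (tnth S i).
pose m i w j : nat := (\sum_(l < n) 2 * absz (k j l) * absz (B%:Z + bc_act w (k i) l)%R)%N.
pose one : 'S_n * {ffun 'I_n -> bool} := (1%g, [ffun=> false]).
have oneE a : bc_act one a = a.
  by apply/ffunP => l; rewrite bc_actE perm1 ffunE mul1r.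
have mE i w j : (m i w j)%:Z = 2 * B%:Z * (\sum_(l < n) k j l) + 2 * dot (bc_act w (k i)) (k j).
  rewrite /m (big_morph Posz PoszD (erefl _)) !mulr_sumr -big_split /=.
  apply: eq_bigr => l _; rewrite !PoszM !gez0_abs; first by ring.
    by rewrite rho_expo_bound.
  by rewrite ltW ?rho_expo_gt0.
pose wt i : nat := (size (v 0%R i) + absz (dot (k i) (k i)))%N.
have [i0 vi0 i0max] := @arg_maxnP _ i1 (fun i => v 0 i != 0) wt vi1.
(* the degree at which the column i0 is read *)
pose d : nat := ((size (v 0%R i0)).-1 + m i0 one i0)%N.
have far i w : (i, w) != (i0, one) -> v 0 i != 0 -> (size (v 0%R i) + m i w i0 <= d)%N.
  move=> iw vi; have := i0max i vi; rewrite /wt /d /= => hmax.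
  have sz0 : (0 < size (v 0%R i0))%N by rewrite lt0n size_poly_eq0.
  have := @dot_lt _ (bc_act w (k i)) (k i0); rewrite dot_bc.
  have -> : bc_act w (k i) != k i0.
    apply: contra iw => /eqP; rewrite -(oneE (k i0)) => /(bc_act_rho_expo_inj (S_part i) (S_part i0)) [-> E].
    rewrite xpair_eqE eqxx andbT; apply/eqP; apply: val_inj => /=.
    by apply/eqP; rewrite -(nth_uniq [tuple of nseq n 0%N] _ _ S_uniq) ?size_tuple // -!tnth_nth E.
  move=> /(_ isT); have := mE i w i0; have := mE i0 one i0; rewrite oneE.
  have := dot_ge0 (k i); have := dot_ge0 (k i0); lia.
have := congr1 (fun M : 'rV[{poly rat}]_N => (M 0 i0)`_d) vM.
rewrite /= !mxE coef0 coef_sum => /eqP; apply/negP.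
have coefE i : (v 0 i * (\matrix_(i < N, j < N)
     alternantB B (fun k => 'X ^+ (2 * absz (rho_expo (tnth S j) k)) : {poly rat}) (tnth S i)) i i0 : {poly rat})`_d
   = \sum_w bc_sign rat w * (v 0 i * 'X^(m i w i0) : {poly rat})`_d.
  rewrite mxE mulr_sumr coef_sum; apply: eq_bigr => w _.
  rewrite mulrCA -(rmorph_bc_sign (@polyC rat)) coefCM; congr (_ * nth 0 (polyseq (_ * _)) d).
  rewrite -prodrXr; apply: eq_bigr => l _; by rewrite -exprM.
have far0 i w : (i, w) != (i0, one) -> (v 0 i * 'X^(m i w i0) : {poly rat})`_d = 0.
  move=> iw; have [->|vi] := eqVneq (v 0 i) 0; first by rewrite mul0r coef0.
  have := far i w iw vi; rewrite coefMXn => h; case: ltnP => // md.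
  by rewrite nth_default // leq_subRL // addnC.
rewrite (bigD1 i0) //= [X in _ + X]big1 ?addr0; last first.
  by move=> i ii0; rewrite coefE big1 // => w _; rewrite far0 ?mulr0 // xpair_eqE negb_and ii0.
rewrite coefE (bigD1 one) //= big1 ?addr0; last first.
  by move=> w w1; rewrite far0 ?mulr0 // xpair_eqE negb_and w1 orbT.
rewrite coefMXn /d ltnNge leq_addl /= addnK mulf_neq0 //; last by rewrite -lead_coefE lead_coef_eq0.
by apply/eqP => E; have := bc_sign_sqr rat one; rewrite E mul0r => /eqP; rewrite eq_sym oner_eq0.
Qed.
End Principal.

(** * Alternants at the interpolation points *)

(** The interpolation points lie in this subring of Kqts, from which, unlike from
    the field, one can specialize. *)
Definition Rqts : comNzRingType := {poly {mpoly rat[2]}}.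

Definition to_Kqts : Rqts -> Kqts := @FracField.tofrac {poly Kqt} \o map_poly (@FracField.tofrac {mpoly rat[2]}).
HB.instance Definition _ := GRing.RMorphism.on to_Kqts.

Lemma to_Kqts_inj p : to_Kqts p = 0 -> p = 0.
Proof.
move=> /eqP; rewrite /to_Kqts /= tofrac_eq0 => /eqP/polyP E.
apply/polyP => i; have := E i; rewrite coef_map !coef0 => /eqP.
by rewrite tofrac_eq0 => /eqP.
Qed.

Definition principal_var (i : 'I_2) : {poly rat} := if i == 0 then 'X else 'X^2.

(** The specialization q^(1/2) -> X, t -> X^2, s -> X^2, that is t = s = q. *)
Definition principal : Rqts -> {poly rat} :=
  horner_eval ('X^2) \o map_poly (mmap (@polyC rat) principal_var).
HB.instance Definition _ := GRing.RMorphism.on principal.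

Definition Rsqrtq : Rqts := ('X_(inord 0) : {mpoly rat[2]})%:P.
Definition Rt : Rqts := ('X_(inord 1) : {mpoly rat[2]})%:P.
Definition Rs : Rqts := 'X.

Definition Rpoint n (nu : n.-tuple nat) (i : 'I_n) : Rqts :=
  (Rsqrtq ^+ 2) ^+ tnth nu i * Rt ^+ (n - i.+1) * Rs.

Lemma to_Kqts_point n (nu : n.-tuple nat) i : to_Kqts (Rpoint nu i) = interp_point nu i.
Proof.
rewrite /Rpoint !(rmorphM to_Kqts) !(rmorphXn to_Kqts) /interp_point /q.
congr (_ ^+ 2 ^+ _ * _ ^+ _ * _); rewrite /= /to_Kqts /=.
- by rewrite map_polyC.
- by rewrite map_polyC.
by rewrite map_polyX.
Qed.

(** The exponents combine to 2 nu_i + 2 (n - i - 1) + 2 = 2 (nu + rho)_i, the index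
    i starting from 0. *)
Lemma principal_point n (nu : n.-tuple nat) i :
  principal (Rpoint nu i) = 'X ^+ (2 * absz (rho_expo nu i)).
Proof.
rewrite /Rpoint !(rmorphM principal) !(rmorphXn principal).
have Xq : principal Rsqrtq = 'X.
  by rewrite /principal /= map_polyC /= mmapX mmap1U /horner_eval hornerC /principal_var -val_eqE /= inordK.
have Xt : principal Rt = 'X^2.
  by rewrite /principal /= map_polyC /= mmapX mmap1U /horner_eval hornerC /principal_var -val_eqE /= inordK.
have Xs : principal Rs = 'X^2 by rewrite /principal /= map_polyX /horner_eval hornerX.
transitivity (('X ^+ 2) ^+ tnth nu i * ('X^2) ^+ (n - i.+1) * 'X^2 : {poly rat}).
  by congr (_ ^+ 2 ^+ _ * _ ^+ _ * _).
rewrite rho_expoE -!exprM -!exprD; congr (_ ^+ _); have := ltn_ord i; lia.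
Qed.

Lemma interp_point_neq0 n (nu : n.-tuple nat) i : interp_point nu i != 0.
Proof.
rewrite -to_Kqts_point; apply/eqP => /to_Kqts_inj/(congr1 principal)/eqP.
by rewrite rmorph0 principal_point -size_poly_eq0 size_polyXn.
Qed.

(** After the denominators x_i^B are cleared the determinant comes from [Rqts],
    and it is nonzero since its principal specialization is. *)
Lemma interp_unitmx n N (S : N.-tuple (n.-tuple nat)) :
  uniq S -> (forall i, is_part (tnth S i)) ->
  \matrix_(i < N, j < N) alternant (interp_point (tnth S j)) (tnth S i) \in unitmx.
Proof.
move=> S_uniq S_part; rewrite unitmxE unitfE.
pose B := \max_(i < N) (sumn (tnth S i) + n).
have S_bound i : (sumn (tnth S i) + n <= B)%N.
  exact: (leq_bigmax_cond (F := fun i => (sumn (tnth S i) + n)%N)).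
apply: contra (det_principal_neq0 S_uniq S_part S_bound) => /det0P[v v0 vM].
pose M0 : 'M[Rqts]_N := \matrix_(i, j) alternantB B (Rpoint (tnth S j)) (tnth S i).
have M00 : \det M0 = 0.
  apply: to_Kqts_inj; rewrite -det_map_mx; apply/eqP/det0P; exists v => //.
  apply/rowP => j; rewrite !mxE.
  have := congr1 (fun M : 'rV_N => M 0 j) vM; rewrite !mxE => vMj.
  rewrite -[RHS](mulr0 (\prod_(l < n) interp_point (tnth S j) l ^+ B)) -[in RHS]vMj mulr_sumr.
  apply: eq_bigr => i _; rewrite !mxE rmorph_alternantB mulrCA; congr (_ * _).
  rewrite -alternantB_alternant //; last by move=> l; apply: interp_point_neq0.
  apply: eq_bigr => w _; congr (_ * _); apply: eq_bigr => l _ /=.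
  by rewrite to_Kqts_point.
rewrite (_ : \matrix_(i, j) _ = map_mx principal M0); first by rewrite det_map_mx M00 rmorph0.
apply/matrixP => i j; rewrite !mxE rmorph_alternantB.
apply: eq_bigr => w _; congr (_ * _); apply: eq_bigr => l _ /=.
by rewrite principal_point.
Qed.

(** * The Weyl denominator and sums over inversions *)

Lemma sg_neg b : sg (~~ b) = - sg b.
Proof. by case: b. Qed.

Lemma sg_addb a b : sg (a (+) b) = sg a * sg b.
Proof. by rewrite /sg signr_addb. Qed.

Section Values.
Variables (K : fieldType) (n : nat).
Implicit Types (y z : 'I_n -> K).

Definition vdm_prod z : K := \prod_(i < n) \prod_(j < n | (i < j)%N) (z i - z j).

Lemma eq_vdm_prod z z' : z =1 z' -> vdm_prod z = vdm_prod z'.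
Proof.
by move=> E; apply: eq_bigr => i _; apply: eq_bigr => j _; rewrite !E.
Qed.

(** The product is a Vandermonde determinant, whose columns are permuted. *)
Lemma vdm_prod_perm (p : 'S_n) z : vdm_prod (fun i => z (p i)) = (-1) ^+ p * vdm_prod z.
Proof.
have E z' : vdm_prod z' = \det (Vandermonde n (\row_i - z' i)).
  rewrite det_Vandermonde; apply: eq_bigr => i _; apply: eq_bigr => j _.
  by rewrite !mxE opprK addrC.
rewrite !E.
have -> : Vandermonde n (\row_i - z (p i)) = col_perm p (Vandermonde n (\row_i - z i)).
  by apply/matrixP => i j; rewrite !mxE.
by rewrite col_permE det_mulmx det_perm odd_permV mulrC.
Qed.

(** With z_i = y_i + 1/y_i this is the denominator of type C; the z_i are invariant
    under inversions, so only the first product sees their signs. *)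
Definition weyl_den y : K :=
  \prod_(i < n) (y i - (y i)^-1) * vdm_prod (fun i => (y i)^-1 + y i).

Lemma weyl_den_bc w y : weyl_den (bc_point w y) = bc_sign K w * weyl_den y.
Proof.
rewrite /weyl_den; have -> : vdm_prod (fun i => (bc_point w y i)^-1 + bc_point w y i) =
    (-1) ^+ w.1 * vdm_prod (fun i => (y i)^-1 + y i).
  rewrite -odd_permV -vdm_prod_perm; apply: eq_vdm_prod => i; rewrite /bc_point.
  by rewrite /sg; case: (w.2 _); rewrite ?expr0z ?expr1z ?exprN1 ?invrK // addrC.
rewrite /bc_sign mulrCA -!mulrA; congr (_ * _); rewrite mulrA; congr (_ * _).
rewrite -big_split (reindex_inj (@perm_inj _ w.1)); apply: eq_bigr => i _.
rewrite /bc_point permK /sg /=; case: (w.2 i); rewrite ?expr0 ?expr1 ?mul1r //.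
by rewrite exprN1 invrK mulN1r opprB.
Qed.

Definition flip (sigma : {ffun 'I_n -> bool}) y i := y i ^ sg (sigma i).

Definition flip_sum (F : ('I_n -> K) -> K) y : K :=
  \sum_(sigma : {ffun 'I_n -> bool}) \prod_(i < n) (-1) ^+ sigma i * F (flip sigma y).

(** An element of BC_n permutes the summands: flipping by sigma after acting by
    w = (p, eps) is flipping by sigma' with sigma'_i = eps_i sigma_(p i), followed by
    the permutation. The product of the signs of eps is left over. *)
Lemma flip_sum_bc F w y :
  (forall z z', z =1 z' -> F z = F z') ->
  (forall (p : 'S_n) z, (forall i, z i != 0) -> F (fun i => z (p i)) = (-1) ^+ p * F z) ->
  (forall i, y i != 0) ->
  flip_sum F (bc_point w y) = bc_sign K w * flip_sum F y.
Proof.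
move=> eqF permF y0; rewrite /flip_sum mulr_sumr.
(* the inverse of sigma -> sigma' *)
pose h (sigma : {ffun 'I_n -> bool}) : {ffun 'I_n -> bool} :=
  [ffun j => (w.2 ((w.1^-1)%g j)) (+) sigma ((w.1^-1)%g j)].
have h_inj : injective h.
  move=> a b /ffunP E; apply/ffunP => i; have := E (w.1 i).
  by rewrite !ffunE permK; apply: addbI.
rewrite (reindex_inj h_inj); apply: eq_bigr => sigma _.
rewrite (reindex_inj (@perm_inj _ w.1)) /=.
have -> : F (flip (h sigma) (bc_point w y)) = (-1) ^+ w.1 * F (flip sigma y).
  rewrite -odd_permV -permF; last by move=> i; rewrite expfz_neq0.
  apply: eqF => i; rewrite /flip /bc_point ffunE exprz_exp sg_addb mulrA -expr2.
  by rewrite /sg sqrr_sign mul1r.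
under eq_bigr do rewrite ffunE permK signr_addb.
by rewrite big_split /= /bc_sign mulrACA [X in X * _]mulrC.
Qed.
End Values.

Section Leval.
Variables (K0 K : fieldType) (n : nat) (f : K0 -> K) (P : laurent K0 n).

Lemma leval_monom (y : 'I_n -> K) :
  leval f P y = \sum_(a <- monalg.msupp P) f (monalg.mcoeff a P) * monom y a.
Proof. by []. Qed.

Lemma eq_leval (y z : 'I_n -> K) : y =1 z -> leval f P y = leval f P z.
Proof.
move=> E; rewrite !leval_monom; apply: eq_bigr => a _; congr (_ * _).
by apply: eq_bigr => i _; rewrite E.
Qed.

Lemma leval_bc w (y : 'I_n -> K) : bc_symmetric P ->
  leval f P (bc_point w y) = leval f P y.
Proof.
move=> symP; rewrite !leval_monom.
transitivity (\sum_(a <- [seq bc_act w b | b <- monalg.msupp P]) f (monalg.mcoeff a P) * monom y a).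
  rewrite big_map; apply: eq_bigr => a _.
  by rewrite symP monom_bc.
apply: perm_big; apply: uniq_perm; rewrite ?fset_uniq //.
  by rewrite map_inj_uniq ?fset_uniq //; apply: bc_act_inj.
apply: (uniq_min_size _ _ _).2.
- by rewrite map_inj_uniq ?fset_uniq //; apply: bc_act_inj.
- move=> a /mapP[b bP ->]; move: bP; rewrite -!monalg.mcoeff_neq0 symP //.
- by rewrite size_map.
Qed.
End Leval.

(** * The factors of the difference operator *)

Section UnitExponents.
Variable n : nat.
Implicit Types (i j : 'I_n) (b : bool).

Definition unit_expo i b : expo n := [ffun j => if j == i then sg b else 0].

Lemma sum_unit_expo (k : nat) i b :
  \sum_(l < n | (l < k)%N) unit_expo i b l = if (i < k)%N then sg b else 0.
Proof.
rewrite big_mkcond (bigD1 i) //= ffunE eqxx big1 ?addr0 // => j /negbTE ji.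
by rewrite ffunE ji if_same.
Qed.

Lemma dom_le_unit_expo0 i : dom_le 0 (unit_expo i false).
Proof.
move=> k; rewrite sum_unit_expo big1; last by move=> l _; rewrite ffunE.
by case: ifP.
Qed.

Lemma dom_le_unit_expo i j b : (i <= j)%N -> dom_le (unit_expo j b) (unit_expo i false).
Proof.
move=> ij k; rewrite !sum_unit_expo; case: (ltnP j k) => jk.
  by rewrite (leq_ltn_trans ij jk); case: b.
by case: ifP.
Qed.

Lemma unit_expo_eq i j b c : (unit_expo i b == unit_expo j c) = (i == j) && (b == c).
Proof.
apply/eqP/andP => [/ffunP E|[/eqP-> /eqP->] //].
have := E i; rewrite !ffunE eqxx {E}; by case: eqP => _; case: b; case: c.
Qed.

Lemma unit_expo0_eq i b : (0 == unit_expo i b) = false.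
Proof. by apply/eqP => /ffunP/(_ i); rewrite !ffunE eqxx; case: b. Qed.

Lemma monom_unit_expo (K : fieldType) (y : 'I_n -> K) i b : monom y (unit_expo i b) = y i ^ sg b.
Proof.
rewrite /monom (bigD1 i) //= ffunE eqxx big1 ?mulr1 // => j /negbTE ji.
by rewrite ffunE ji expr0z.
Qed.

Lemma card_ord_gt (l : 'I_n) : #|[pred j : 'I_n | (l < j)%N]| = (n - l.+1)%N.
Proof.
transitivity (\sum_(0 <= j < n | (l < j)%N) 1)%N; first by rewrite big_mkord sum1_card.
rewrite big_mkcond (@big_cat_nat _ _ _ l.+1) //= big_nat big1 ?add0n; last first.
  by move=> j /andP[_ jl]; rewrite ltnNge -ltnS jl.
rewrite (eq_big_nat _ _ (F2 := fun=> 1%N)) ?sum_nat_const_nat ?muln1 //.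
by move=> j /andP[->].
Qed.

(** The top exponents of the factors add up to rho: e_i occurs once in the factor
    of the variable i and once for each of the n - i - 1 pairs i < j, indices starting from 0. *)
Lemma sum_unit_expo_rho (lam : n.-tuple nat) :
  \sum_(i < n) unit_expo i false + (\sum_(i < n) \sum_(j < n | (i < j)%N) unit_expo i false + part_expo lam)
  = rho_expo lam.
Proof.
have sumE (I : Type) (r : seq I) (Q : pred I) (F : I -> expo n) l :
    (\sum_(i <- r | Q i) F i) l = \sum_(i <- r | Q i) F i l.
  by apply: (big_morph (fun a : expo n => a l)) => [a b|]; rewrite ffunE.
have seE i l : unit_expo i false l = (l == i)%:Z by rewrite ffunE; case: eqP.
apply/ffunP => l; rewrite rho_expoE !expoD !sumE.
rewrite (bigD1 l) //= seE eqxx big1 ?addr0; last first.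
  by move=> i /negbTE il; rewrite seE eq_sym il.
rewrite (bigD1 l) //= [X in _ + (_ + X + _)]big1 ?addr0; last first.
  by move=> i /negbTE il; rewrite sumE big1 // => j _; rewrite seE eq_sym il.
rewrite sumE [X in _ + (X + _)](eq_bigr (fun=> 1)); last by move=> j _; rewrite seE eqxx.
rewrite sumr_const ffunE.
rewrite card_ord_gt -natz; have := ltn_ord l; lia.
Qed.
End UnitExponents.

Section Factors.
Variables (L : fieldType) (n : nat) (s u : L).
Implicit Types (sigma : {ffun 'I_n -> bool}).

(** The expansion of - 1/y (1 - s y) (1 - u y / s) at y = x_i^(sigma_i). *)
Definition var_factor sigma i : lexpr L n :=
  [:: (-1, unit_expo i (~~ sigma i)); (s + u / s, 0); (- u, unit_expo i (sigma i))].

(** The expansion of (1 - t y_i y_j) (1/y_i - 1/y_j) at y = x^sigma. All four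
    exponents are at most e_i in dominance order since i < j. *)
Definition pair_factor (t : L) sigma i j : lexpr L n :=
  [:: (1, unit_expo i (~~ sigma i)); (t, unit_expo i (sigma i));
      (-1, unit_expo j (~~ sigma j)); (- t, unit_expo j (sigma j))].

Definition den_factor i : lexpr L n := [:: (1, unit_expo i false); (-1, unit_expo i true)].

(** The image of P(x r^sigma) under g on coefficients. *)
Definition scaled_poly (K0 : fieldType) (g : K0 -> L) (P : laurent K0 n) (r : L)
    sigma : lexpr L n :=
  [seq (g (monalg.mcoeff a P) * monom (fun i => r ^ sg (sigma i)) a, a) | a <- monalg.msupp P].

Lemma var_factor_top sigma i :
  has_top (var_factor sigma i) (unit_expo i false) (if sigma i then -1 else - u).
Proof.
split=> [p|].
  by rewrite !inE => /or3P[]/eqP-> /=; [apply: dom_le_unit_expo | apply: dom_le_unit_expo0 | apply: dom_le_unit_expo].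
rewrite /coef !big_cons big_nil /= !unit_expo_eq unit_expo0_eq eqxx /=.
by case: (sigma i); rewrite /= addr0.
Qed.

Lemma pair_factor_top t sigma (i j : 'I_n) : (i < j)%N ->
  has_top (pair_factor t sigma i j) (unit_expo i false) (if sigma i then 1 else t).
Proof.
move=> ij; split=> [p|].
  by rewrite !inE => /or4P[]/eqP-> /=; apply: dom_le_unit_expo; rewrite // ltnW.
have ji : (j == i) = false by rewrite -val_eqE gtn_eqF.
by rewrite /coef !big_cons big_nil /= !unit_expo_eq ji eqxx /=; case: (sigma i); rewrite /= ?addr0.
Qed.

Lemma den_factor_top i : has_top (den_factor i) (unit_expo i false) 1.
Proof.
split=> [p|]; first by rewrite !inE => /orP[]/eqP-> /=; apply: dom_le_unit_expo.
by rewrite /coef !big_cons big_nil /= !unit_expo_eq eqxx /= addr0.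
Qed.

Section Ev.
Variables (K : fieldType) (f : {rmorphism L -> K}) (y : 'I_n -> K).
Hypothesis y0 : forall i, y i != 0.

Lemma ev_var_factor sigma i :
  ev f y (var_factor sigma i) =
  - (flip sigma y i)^-1 + (f s + f u / f s) - f u * flip sigma y i.
Proof.
rewrite /ev !big_cons big_nil /= !monom_unit_expo monom0 rmorphN1 !rmorphD rmorphN fmorph_div /flip sg_neg invr_expz.
by rewrite mulr1 addr0 mulN1r mulNr addrA.
Qed.

Lemma ev_pair_factor t sigma i j :
  ev f y (pair_factor t sigma i j) =
  ((flip sigma y i)^-1 + f t * flip sigma y i) - ((flip sigma y j)^-1 + f t * flip sigma y j).
Proof.
rewrite /ev !big_cons big_nil /= !monom_unit_expo rmorphN1 rmorph1 rmorphN /flip !sg_neg !invr_expz.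
by ring.
Qed.

Lemma ev_den_factor i : ev f y (den_factor i) = y i - (y i)^-1.
Proof.
by rewrite /ev !big_cons big_nil /= !monom_unit_expo rmorphN1 rmorph1 mul1r mulN1r addr0.
Qed.

Lemma ev_scaled_poly (K0 : fieldType) (g : K0 -> L) (P : laurent K0 n) r sigma :
  ev f y (scaled_poly g P r sigma) =
  leval (fun c => f (g c)) P (fun i => y i * f r ^ sg (sigma i)).
Proof.
rewrite /ev big_map leval_monom; apply: eq_bigr => a _ /=.
rewrite rmorphM -mulrA; congr (_ * _); rewrite /monom rmorph_prod -big_split /=.
apply: eq_bigr => i _; by rewrite !fmorphXz expfzMl mulrC.
Qed.
End Ev.
End Factors.

(** * Interpolation polynomials and cleared denominators *)

Section Dominated.
Variable n : nat.
Implicit Types (mu nu lam : n.-tuple nat).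

Lemma sumn_take mu k : sumn (take k mu) = \sum_(i < n | (i < k)%N) tnth mu i.
Proof.
rewrite sumnE (big_nth 0%N) size_take size_tuple.
have -> : (if (k < n)%N then k else n) = minn k n by [].
rewrite (big_nat_widen _ _ n) ?geq_minr // big_mkord.
apply: eq_big => [i|i /andP[_ ik]]; first by have := ltn_ord i; rewrite /= ltn_min => ->; rewrite andbT.
by rewrite nth_take ?(tnth_nth 0%N) //; move: ik; rewrite ltn_min => /andP[].
Qed.

Lemma part_expo_inj : injective (@part_expo n).
Proof.
move=> mu nu /ffunP E; apply: eq_from_tnth => i.
by have := E i; rewrite !ffunE => -[].
Qed.

Lemma sum_part_expo mu k :
  \sum_(i < n | (i < k)%N) part_expo mu i = (sumn (take k mu))%:Z.
Proof.
rewrite sumn_take (big_morph Posz PoszD (erefl _)).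
by apply: eq_bigr => i _; rewrite ffunE.
Qed.

Lemma dominated_dom_le mu nu : dominated mu nu <-> dom_le (part_expo mu) (part_expo nu).
Proof.
split=> [H k|H k k0]; last by have := H k; rewrite !sum_part_expo.
rewrite !sum_part_expo; case: k => [|k]; first by rewrite !take0.
by have := H k.+1 isT.
Qed.

Lemma rho_expo_part_expo mu : rho_expo mu = part_expo mu + [ffun i : 'I_n => (n - i)%:Z].
Proof. by apply/ffunP => i; rewrite rho_expoE expoD !ffunE PoszD. Qed.

Lemma dom_le_rho_expo mu nu : dom_le (rho_expo mu) (rho_expo nu) -> dominated mu nu.
Proof.
move=> H; apply/dominated_dom_le => k; have := H k; rewrite !rho_expo_part_expo.
by rewrite !(eq_bigr _ (fun i _ => expoD _ _ i)) !big_split /= lerD2r.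
Qed.

Lemma dominated_sdominated mu nu lam :
  dominated mu nu -> sdominated nu lam -> sdominated mu lam.
Proof.
move=> /dominated_dom_le mn [/dominated_dom_le nl nel]; split.
  by apply/dominated_dom_le; apply: dom_le_trans nl.
move=> E; apply: nel; apply: part_expo_inj; apply: dom_le_antisym => //.
by rewrite -E.
Qed.
End Dominated.

Section InterpolationSupport.
Variables (K : fieldType) (n : nat).

Lemma mcoeff_m_orbit (lam : n.-tuple nat) a :
  monalg.mcoeff a (m_orbit K lam) = (a \in bc_orbit (part_expo lam))%:R.
Proof.
rewrite /m_orbit raddf_sum /=.
under eq_bigr do rewrite monalg.mcoeffU.
have [ia|ia] := boolP (a \in bc_orbit (part_expo lam)).
  rewrite (bigD1_seq a) ?undup_uniq //= eqxx big1 ?addr0 // => b /negbTE ->.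
  by rewrite mulr0n.
rewrite big_seq big1 // => b ib; case: eqP => [E|_]; last by rewrite mulr0n.
by move: ia; rewrite -E ib.
Qed.

Lemma bc_orbit_dom_le (mu : n.-tuple nat) a : is_part mu ->
  a \in bc_orbit (part_expo mu) -> dom_le a (part_expo mu).
Proof.
by move=> pmu; rewrite mem_undup => /mapP[w _ ->]; apply: dom_le_bc_act.
Qed.

Lemma bc_orbit_refl (a : expo n) : a \in bc_orbit a.
Proof.
rewrite mem_undup; apply/mapP; exists (1%g, [ffun=> false]); first by rewrite mem_enum.
by apply/ffunP => i; rewrite bc_actE /= perm1 ffunE mul1r.
Qed.
End InterpolationSupport.

(** The hypothesis gives P in terms of orbit sums; every orbit lies below its
    partition by the rearrangement inequality. *)
Lemma interpolation_support n (lam : n.-tuple nat) (P : laurent Kqts n) :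
  is_part lam -> is_interpolation P lam ->
  (forall a, a \in monalg.msupp P -> dom_le a (part_expo lam))
  /\ monalg.mcoeff (part_expo lam) P = 1.
Proof.
move=> plam [_ [r [c [hr ->]]] _]; split=> [a|].
  rewrite -monalg.mcoeff_neq0 monalg.mcoeffD mcoeff_m_orbit raddf_sum /=.
  have [ia _|_] := boolP (a \in _); first exact: bc_orbit_dom_le.
  rewrite add0r => ca; have [mu mur] : exists2 mu, mu \in r & monalg.mcoeff a (c mu *: m_orbit Kqts mu) != 0.
    apply/hasP; apply: contraR ca => /hasPn H; rewrite big_seq big1 // => mu /H.
    by rewrite negbK => /eqP.
  rewrite monalg.mcoeffZ mcoeff_m_orbit; have [pmu [dmu _]] := hr _ mur.
  have [ia _|_] := boolP (a \in _); last by rewrite mulr0 eqxx.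
  by apply: dom_le_trans (bc_orbit_dom_le pmu ia) _; apply/dominated_dom_le.
rewrite monalg.mcoeffD mcoeff_m_orbit bc_orbit_refl raddf_sum /= big_seq big1 ?addr0 // => mu mur.
have [pmu [dmu nmu]] := hr _ mur.
rewrite monalg.mcoeffZ mcoeff_m_orbit; case: (boolP (_ \in _)) => [ia|_]; last by rewrite mulr0.
case: nmu; apply: part_expo_inj; apply: dom_le_antisym; first exact/dominated_dom_le.
exact: bc_orbit_dom_le.
Qed.

Lemma scaled_poly_top n (lam : n.-tuple nat) (P : laurent Kqts n) (L : fieldType)
    (g : Kqts -> L) (r : L) sigma :
  is_part lam -> is_interpolation P lam -> g 1 = 1 ->
  has_top (scaled_poly g P r sigma) (part_expo lam)
    (monom (fun i => r ^ sg (sigma i)) (part_expo lam)).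
Proof.
move=> plam intP g1; have [suppP P1] := interpolation_support plam intP.
split=> [p /mapP[a aP ->]|]; first exact: suppP.
rewrite /coef big_map /= (eq_bigl (pred1 (part_expo lam))) //.
rewrite big_mkcond (bigD1_seq (part_expo lam)) ?fset_uniq //=; last first.
  by rewrite -monalg.mcoeff_neq0 P1 oner_neq0.
rewrite eqxx P1 g1 mul1r big1 ?addr0 // => a /negbTE ->.
by [].
Qed.

Section GenericPoint.
Variables (L : fieldType) (n : nat).
Local Notation x := (@rf_var L n).

Lemma generic_monom_neq1 (a : expo n) : a != 0 -> 1 - monom x a != 0.
Proof.
move=> a0; apply/eqP => E.
have := @ev_generic_eq0 L n [:: (1, 0); (-1, a)].
rewrite /ev /coef !big_cons big_nil /= rmorph1 rmorphN1 monom0 mulr1 mulN1r addr0 E.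
move=> /(_ erefl 0)/eqP; rewrite !big_cons big_nil /= eqxx (negbTE a0) addr0.
by rewrite oner_eq0.
Qed.

(** The Weyl denominator as an expression: its pair factors are those of the
    operator at t = 1 and without inversions. *)
Definition den_list : lexpr L n :=
  lmul (\big[@lmul L n/lone L n]_(i < n) den_factor L i)
    (\big[@lmul L n/lone L n]_(i < n) \big[@lmul L n/lone L n]_(j < n | (i < j)%N)
       pair_factor 1 [ffun=> false] i j).

Lemma den_list_top :
  has_top den_list
    (\sum_(i < n) unit_expo i false + \sum_(i < n) \sum_(j < n | (i < j)%N) unit_expo i false) 1.
Proof.
have -> : 1 = (\prod_(i < n) 1) * \prod_(i < n) \prod_(j < n | (i < j)%N) (if [ffun=> false] i then 1 else 1) :> L.
  rewrite !big1 ?mulr1 // => i _; rewrite big1 // => j _; by rewrite if_same.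
apply: has_top_mul; apply: has_top_prod => i _; first exact: den_factor_top.
by apply: has_top_prod => j ij; apply: pair_factor_top.
Qed.

Lemma ev_den_list (K : fieldType) (f : {rmorphism L -> K}) (y : 'I_n -> K) :
  (forall i, y i != 0) -> ev f y den_list = weyl_den y.
Proof.
move=> y0; rewrite ev_mul // !ev_prod // /weyl_den; congr (_ * _).
  by apply: eq_bigr => i _; rewrite ev_den_factor.
apply: eq_bigr => i _; rewrite ev_prod //; apply: eq_bigr => j _.
by rewrite ev_pair_factor rmorph1 !mul1r /flip !ffunE.
Qed.

(** Its top coefficient is 1. *)
Lemma generic_weyl_den_neq0 : weyl_den x != 0.
Proof.
rewrite -(ev_den_list (@rf_const L n)); last exact: rf_var_neq0.
apply/eqP => /ev_generic_eq0 E; have [_] := den_list_top.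
by rewrite E => /eqP; rewrite eq_sym oner_eq0.
Qed.
End GenericPoint.

(** Up to the sign of sigma, Delta can be evaluated at z. Then z_i - 1/z_i cancels
    1 - z_i^2, and the identity
    (1/a + a) - (1/b + b) = (1 - a b) (1/a - 1/b) handles the pairs. *)
Lemma weyl_den_ratio (K : fieldType) n (s t u : K) (y : 'I_n -> K) sigma :
  let z := flip sigma y in
  s != 0 -> (forall i, y i != 0) -> (forall i, 1 - z i ^+ 2 != 0) ->
  (forall i j : 'I_n, (i < j)%N -> 1 - z i * z j != 0) ->
  weyl_den y *
    ((\prod_(i < n) ((1 - s * z i) * (1 - u * z i / s) / (1 - z i ^+ 2)))
     * \prod_(i < n) \prod_(j < n | (i < j)%N) ((1 - t * z i * z j) / (1 - z i * z j)))
  = \prod_(i < n) (-1) ^+ sigma i *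
     ((\prod_(i < n) (- (z i)^-1 + (s + u / s) - u * z i))
      * vdm_prod (fun i => (z i)^-1 + t * z i)).
Proof.
move=> z s0 y0 z2 zz.
have z0 i : z i != 0 by rewrite expfz_neq0.
have -> : weyl_den y = \prod_(i < n) (-1) ^+ sigma i * weyl_den z.
  have E : weyl_den z = bc_sign K (1%g, sigma) * weyl_den y.
    rewrite -weyl_den_bc /weyl_den; congr (_ * _); last apply: eq_vdm_prod.
      by apply: eq_bigr => i _; rewrite /bc_point /= invg1 perm1.
    by move=> i; rewrite /bc_point /= invg1 perm1.
  have -> : \prod_(i < n) (-1) ^+ sigma i = bc_sign K (1%g, sigma).
    by rewrite /bc_sign odd_perm1 mul1r.
  by rewrite E mulrA bc_sign_sqr mul1r.
rewrite -[LHS]mulrA; congr (_ * _); rewrite /weyl_den mulrACA -big_split /=; congr (_ * _).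
  apply: eq_bigr => i _; field; by rewrite s0 z0 z2.
rewrite /vdm_prod -big_split; apply: eq_bigr => i _ /=; rewrite -big_split; apply: eq_bigr => j ij /=.
field; by rewrite zz // !z0.
Qed.

(** * The numerator of the difference operator *)

Section Numerator.
Variables (L : fieldType) (n : nat) (s t u r : L).
Variables (P : laurent Kqts n) (g : Kqts -> L).

Definition op_term sigma : lexpr L n :=
  lmul (\big[@lmul L n/lone L n]_(i < n) var_factor s u sigma i)
    (lmul (\big[@lmul L n/lone L n]_(i < n) \big[@lmul L n/lone L n]_(j < n | (i < j)%N)
       pair_factor t sigma i j)
     (scaled_poly g P r sigma)).

(** The right-hand side of the difference equation times the Weyl denominator,
    r and g standing for q^(1/2) and for the shift of s on coefficients. *)
Definition op_num : lexpr L n :=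
  \big[cat/[::]]_(sigma : {ffun 'I_n -> bool})
    lscale (\prod_(i < n) (-1) ^+ sigma i) (op_term sigma).

Definition op_eigenvalue (lam : n.-tuple nat) : L :=
  r ^- sumn lam * \prod_(i < n) (1 - (r ^+ 2) ^+ tnth lam i * t ^+ (n - i.+1) * u).

(** The top coefficient of the summand sigma is a product over i of a factor that
    depends on sigma_i alone, namely (indices from 0) - u t^(n-i-1) r^lam_i for +1 and r^(- lam_i)
    for -1 (the sign of sigma included). Hence the sum over sigma is the product
    of the r^(- lam_i) (1 - r^(2 lam_i) t^(n-i-1) u). *)
Lemma op_num_top (lam : n.-tuple nat) :
  r != 0 -> is_part lam -> is_interpolation P lam -> g 1 = 1 ->
  has_top op_num (rho_expo lam) (op_eigenvalue lam).
Proof.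
move=> r0 plam intP g1.
pose c sigma : L := (\prod_(i < n) (if sigma i then -1 else - u)) *
  ((\prod_(i < n) \prod_(j < n | (i < j)%N) (if sigma i then 1 else t)) *
   monom (fun i => r ^ sg (sigma i)) (part_expo lam)).
have topT (sigma : {ffun 'I_n -> bool}) : has_top (op_term sigma) (rho_expo lam) (c sigma).
  rewrite -sum_unit_expo_rho; apply: has_top_mul.
    by apply: has_top_prod => i _; apply: var_factor_top.
  apply: has_top_mul; last exact: scaled_poly_top.
  apply: has_top_prod => i _; apply: has_top_prod => j ij.
  exact: pair_factor_top.
(* the factor of the index i, as a function of sigma_i *)
pose F (i : 'I_n) (b : bool) : L := (-1) ^+ b * (if b then -1 else - u) *
  (if b then 1 else t) ^+ (n - i.+1) * (r ^ sg b) ^ (tnth lam i)%:Z.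
have -> : op_eigenvalue lam = \sum_(sigma : {ffun 'I_n -> bool}) \prod_(i < n) F i (sigma i).
  rewrite -(bigA_distr_bigA F) /op_eigenvalue.
  rewrite sumnE big_tuple -prodrXr -prodfV -big_split /=; apply: eq_bigr => i _.
  rewrite big_bool /F /= expr1n !expr0 !expr1 /sg expr0 expr1 expr1z.
  rewrite exprN1 -!exprnP exprVn -exprM mulnC exprM.
  have : r ^+ tnth lam i != 0 by rewrite expf_neq0.
  by move: (r ^+ _) (t ^+ _) => R T R0; field.
apply: has_top_sum => sigma _.
rewrite [X in has_top _ _ X](_ : _ = \prod_(i < n) (-1) ^+ sigma i * c sigma).
  exact: has_top_scale.
rewrite /F /c /monom !big_split /= !mulrA; congr (_ * _ * _); last first.
  by apply: eq_bigr => i _; rewrite ffunE.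
by apply: eq_bigr => i _; rewrite prodr_const card_ord_gt.
Qed.

Section Evaluation.
Variables (K : fieldType) (f : {rmorphism L -> K}).

Definition op_summand (z : 'I_n -> K) : K :=
  (\prod_(i < n) (- (z i)^-1 + (f s + f u / f s) - f u * z i))
  * (vdm_prod (fun i => (z i)^-1 + f t * z i)
     * leval (fun c => f (g c)) P (fun i => z i * f r)).

Lemma ev_op_term y sigma : (forall i, y i != 0) ->
  ev f y (op_term sigma) =
  (\prod_(i < n) (- (flip sigma y i)^-1 + (f s + f u / f s) - f u * flip sigma y i))
  * (vdm_prod (fun i => (flip sigma y i)^-1 + f t * flip sigma y i)
     * leval (fun c => f (g c)) P (fun i => y i * f r ^ sg (sigma i))).
Proof.
move=> y0; rewrite !ev_mul // ev_scaled_poly; congr (_ * (_ * _)).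
  by rewrite ev_prod //; apply: eq_bigr => i _; rewrite ev_var_factor.
rewrite ev_prod //; apply: eq_bigr => i _; rewrite ev_prod //; apply: eq_bigr => j _.
by rewrite ev_pair_factor.
Qed.

Lemma ev_op_num y : (forall i, y i != 0) ->
  ev f y op_num = \sum_(sigma : {ffun 'I_n -> bool})
    \prod_(i < n) (-1) ^+ sigma i * ev f y (op_term sigma).
Proof.
move=> y0; rewrite ev_sum //; apply: eq_bigr => sigma _.
rewrite ev_scale rmorph_prod; congr (_ * _).
by apply: eq_bigr => i _; rewrite rmorph_sign.
Qed.

Hypothesis symP : bc_symmetric P.

(** By the symmetry of P under inversions, its value at x r^sigma equals the value
    at x^sigma r. This exhibits the numerator as an alternating sum of one
    function over the flips of its argument. *)
Lemma ev_op_num_flip y : (forall i, y i != 0) -> ev f y op_num = flip_sum op_summand y.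
Proof.
move=> y0; rewrite ev_op_num //; apply: eq_bigr => sigma _; congr (_ * _).
rewrite ev_op_term // /op_summand; congr (_ * (_ * _)).
rewrite -(leval_bc _ (1%g, sigma) _ symP); apply: eq_leval => i.
rewrite /bc_point /= invg1 perm1 expfzMl exprz_exp -expr2.
by rewrite /sg sqrr_sign expr1z.
Qed.

Lemma ev_op_num_bc w y : (forall i, y i != 0) ->
  ev f (bc_point w y) op_num = bc_sign K w * ev f y op_num.
Proof.
move=> y0; rewrite !ev_op_num_flip //; last exact: bc_point_neq0.
apply: flip_sum_bc => // [z z' E|p z z0].
  rewrite /op_summand; congr (_ * (_ * _)).
  - by apply: eq_bigr => i _; rewrite E.
  - by apply: eq_vdm_prod => i; rewrite E.
  by apply: eq_leval => i; rewrite E.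
rewrite /op_summand (vdm_prod_perm p (fun i => (z i)^-1 + f t * z i)).
rewrite -(leval_bc _ ((p^-1)%g, [ffun=> false]) (fun i => z i * f r) symP).
rewrite (eq_leval _ _ (z := fun i => z (p i) * f r)); last first.
  by move=> i; rewrite /bc_point /= invgK ffunE expr1z.
rewrite -(reindex_inj (P := xpredT) (F := fun i => - (z i)^-1 + (f s + f u / f s) - f u * z i) (@perm_inj _ p)).
by rewrite -(mulrA ((-1) ^+ p)) mulrCA.
Qed.
End Evaluation.
End Numerator.

Lemma shift_s_interp_point n (mu : n.-tuple nat) i :
  shift_s (interp_point mu i) = interp_point mu i * sqrtq.
Proof.
have gen (f : {rmorphism Kqts -> Kqts}) (a b c : Kqts) k l :
    f a = a -> f b = b -> f c = c * a ->
    f ((a ^+ 2) ^+ k * b ^+ l * c) = (a ^+ 2) ^+ k * b ^+ l * c * a.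
  by move=> fa fb fc; rewrite !rmorphM !rmorphXn fa fb fc mulrA.
by apply: (gen shift_s); [apply: shift_s_const | apply: shift_s_const | apply: shift_s_s].
Qed.

Section Vanishing.
Variables (n : nat) (lam : n.-tuple nat) (P : laurent Kqts n).
Hypothesis intP : is_interpolation P lam.
Variables (L : fieldType) (iota : {rmorphism Kqts -> L}) (u : L).

(** At the point of nu the factor of the last variable vanishes if nu_n = 0 and
    sigma_n = -1, and the factor of a pair (i, i+1) vanishes if nu_i = nu_(i+1),
    sigma_i = -1 and sigma_(i+1) = 1. In the remaining cases the parts nu_i with
    sigma_i = -1 can be lowered by 1, and P is evaluated at the point of the
    resulting partition, with s q^(1/2) for s. *)
Lemma op_num_vanish nu : is_part nu -> sdominated nu lam ->
  ev (idfun : {rmorphism L -> L}) (iota \o interp_point nu)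
    (op_num (iota s) (iota t) u (iota sqrtq) P (iota \o shift_s)) = 0.
Proof.
move=> pnu dnu; set y := iota \o _.
have t_neq0 : t != 0.
  by rewrite /t tofrac_eq0 polyC_eq0 /t0 tofrac_eq0 -msupp_eq0 msuppX.
have s_neq0 : s != 0 by rewrite /s tofrac_eq0 polyX_eq0.
have r_neq0 : sqrtq != 0.
  by rewrite /sqrtq tofrac_eq0 polyC_eq0 /sqrtq0 tofrac_eq0 -msupp_eq0 msuppX.
have y0 i : y i != 0 by rewrite fmorph_eq0 interp_point_neq0.
rewrite ev_op_num // big1 // => sigma _; rewrite ev_op_term //=.
have [/existsP[i /andP[/eqP li /andP[si /eqP nui]]]|last0] :=
    boolP [exists i : 'I_n, (i.+1 == n) && (sigma i && (tnth nu i == 0%N))].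
  rewrite [X in _ * (X * _)](bigD1 i) //= [X in _ * (X * _ * _)](_ : _ = 0) ?mul0r ?mulr0 //.
  rewrite /flip si /sg expr1 exprN1 invrK /y /= /interp_point nui li subnn !expr0 !mul1r.
  have : iota s != 0 by rewrite fmorph_eq0.
  by move: (iota s) => s' s'0; field.
have [/existsP[i /existsP[j /andP[/eqP ji /and3P[si sj /eqP nuij]]]]|adj] :=
    boolP [exists i : 'I_n, exists j : 'I_n,
      (j == i.+1 :> nat) && [&& sigma i, ~~ sigma j & tnth nu i == tnth nu j]].
  rewrite [vdm_prod _](_ : _ = 0) ?mul0r ?mulr0 //.
  rewrite /vdm_prod (bigD1 i) //= (bigD1 j) ?ji //= [X in X * _ * _](_ : _ = 0) ?mul0r //.
  rewrite /flip si (negbTE sj) /sg expr1 expr0 expr1z exprN1 invrK.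
  have -> : y i = iota t * y j.
    rewrite /y /= -rmorphM; congr (iota _); rewrite /interp_point nuij ji.
    have -> : (n - i.+1 = (n - i.+2).+1)%N by have := ltn_ord j; lia.
    rewrite exprS; move: (t) (s) (q ^+ _) (t ^+ _) => a b c d; ring.
  have : iota t != 0 by rewrite fmorph_eq0.
  by move: (iota t) (y j) (y0 j) => t' z z0 t'0; field; rewrite z0 t'0.
(* lower the parts with sigma_i = -1 *)
pose mu := [tuple (tnth nu i - sigma i)%N | i < n].
have muE i : tnth mu i = (tnth nu i - sigma i)%N by rewrite tnth_mktuple.
have adjP (i j : 'I_n) : j = i.+1 :> nat -> sigma i -> tnth nu i = tnth nu j -> sigma j.
  move=> ji si nuij; apply: contraR adj => sj; apply/existsP; exists i; apply/existsP; exists j.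
  by rewrite ji nuij si sj !eqxx.
(* an equality nu_i = nu_(i+1) = 0 would propagate sigma = -1 to the last index *)
have pos k (i : 'I_n) : (n - i.+1 = k)%N -> sigma i -> (0 < tnth nu i)%N.
  elim: k i => [|k IH] i ik si.
    rewrite lt0n; apply: contra last0 => nui; apply/existsP; exists i; rewrite si nui !andbT.
    have := ltn_ord i; lia.
  have lti : (i.+1 < n)%N by lia.
  have := is_part_le (i := i) (j := Ordinal lti) pnu (leqnSn _).
  have [nuij|] := eqVneq (tnth nu i) (tnth nu (Ordinal lti)); last by lia.
  by rewrite nuij => _; apply: IH; [rewrite /=; lia | apply: (adjP i)].
have pmu : is_part mu.
  apply: is_part_intro => i j ji; rewrite !muE.
  have := is_part_le (i := i) (j := j) pnu (ltnW (eq_leq (esym ji))).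
  have := adjP i j ji; have := pos _ j erefl.
  case: (sigma i) => [/=|]; case: (sigma j) => //=; lia.
have dmu : sdominated mu lam.
  apply: dominated_sdominated dnu => k _; rewrite !sumn_take.
  by apply: leq_sum => i _; rewrite muE leq_subr.
have vanmu : leval id P (interp_point mu) = 0 by case: intP => _ _; apply.
have mul40 (a b c d : L) : d = 0 -> a * (b * (c * d)) = 0 by move->; rewrite !mulr0.
apply: mul40; transitivity (iota (shift_s (leval id P (interp_point mu)))); last first.
  by rewrite vanmu (rmorph0 shift_s) (rmorph0 iota).
rewrite !leval_monom (rmorph_sum shift_s) (rmorph_sum iota); apply: eq_bigr => a _.
rewrite (rmorphM shift_s) (rmorphM iota); congr (_ * _).
rewrite /monom (rmorph_prod shift_s) (rmorph_prod iota); apply: eq_bigr => i _.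
rewrite (fmorphXz shift_s) (fmorphXz iota); congr (_ ^ _).
rewrite -(fmorphXz iota) /y /= -(rmorphM iota); congr (iota _).
have gen (K : fieldType) (a1 b c : K) k (b0 : bool) : a1 != 0 -> (b0 -> (0 < k)%N) ->
    (a1 ^+ 2) ^+ k * b * c * a1 ^ sg b0 = (a1 ^+ 2) ^+ (k - b0) * b * c * a1.
  rewrite /sg; case: b0 => [a0 /(_ isT) k0|_ _]; last by rewrite expr0 expr1z subn0.
  rewrite expr1 exprN1 -{1}(subnK k0) addn1 exprS; field.
  by [].
by rewrite shift_s_interp_point /interp_point /q muE; apply: gen r_neq0 (pos _ i erefl).
Qed.
End Vanishing.

(** * Uniqueness and the difference equation *)

(** Antisymmetry of values passes to coefficients because the generic point
    separates them. *)
Lemma coef_anti (L : fieldType) n (e : lexpr L n) :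
  (forall w, ev (@rf_const L n) (bc_point w (@rf_var L n)) e
     = bc_sign _ w * ev (@rf_const L n) (@rf_var L n) e) ->
  forall w a, coef e (bc_act w a) = bc_sign L w * coef e a.
Proof.
move=> H w a.
have := @ev_generic_eq0 L n ([seq (p.1, bc_act w p.2) | p <- e] ++ lscale (- bc_sign L w) e).
rewrite ev_cat ev_scale rmorphN rmorph_bc_sign mulNr -H.
have -> : ev (@rf_const L n) (@rf_var L n) [seq (p.1, bc_act w p.2) | p <- e]
    = ev (@rf_const L n) (bc_point w (@rf_var L n)) e.
  by rewrite /ev big_map; apply: eq_bigr => p _; rewrite monom_bc.
rewrite subrr => /(_ erefl (bc_act w a)); rewrite coef_cat coef_map_bc coef_scale mulNr.
by move/subr0_eq => ->; rewrite mulrA bc_sign_sqr mul1r.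
Qed.

Lemma Kqts_char2 : (1 + 1 : Kqts) != 0.
Proof.
rewrite -(rmorph1 to_Kqts) -rmorphD; apply/eqP => /to_Kqts_inj/(congr1 principal)/eqP.
by rewrite rmorphD rmorph1 rmorph0 -polyC1 -polyCD polyC_eq0.
Qed.

(** The expression is a combination of alternants of partitions nu < lam, and the
    vector of its coefficients is annihilated by the invertible matrix of
    [interp_unitmx], carried to L. *)
Lemma antisymmetric_interpolation (L : fieldType) (iota : {rmorphism Kqts -> L})
    n (lam : n.-tuple nat) (e : lexpr L n) :
  (forall w a, coef e (bc_act w a) = bc_sign L w * coef e a) ->
  has_top e (rho_expo lam) 0 ->
  (forall nu, is_part nu -> sdominated nu lam ->
     ev (idfun : {rmorphism L -> L}) (iota \o interp_point nu) e = 0) ->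
  forall (K : fieldType) (f : {rmorphism L -> K}) (y : 'I_n -> K), ev f y e = 0.
Proof.
move=> anti [dome tope] vane K f y.
have char2 : (1 + 1 : L) != 0.
  by rewrite -(rmorph1 iota) -rmorphD fmorph_eq0 Kqts_char2.
(* recovers nu from nu + rho *)
pose inv (a : expo n) : n.-tuple nat := [tuple (absz (a i) - (n - i))%N | i < n].
have invK nu : inv (rho_expo nu) = nu.
  by apply: eq_from_tnth => i; rewrite tnth_mktuple rho_expoE addnK.
pose S := undup [seq nu <- map inv (map snd e) | is_part nu && (coef e (rho_expo nu) != 0)].
have uS : uniq S by apply: undup_uniq.
have pS nu : nu \in S -> is_part nu.
  by rewrite mem_undup mem_filter => /andP[/andP[]].
have hS nu : is_part nu -> coef e (rho_expo nu) != 0 -> nu \in S.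
  move=> pnu cnu; rewrite mem_undup mem_filter pnu cnu -[nu in nu \in _]invK map_f //.
  by apply: contraR cnu => /coef_out ->.
have dS nu : nu \in S -> sdominated nu lam.
  rewrite mem_undup mem_filter => /andP[/andP[pnu cnu] _]; split; last first.
    by move=> E; rewrite E tope eqxx in cnu.
  apply: dom_le_rho_expo; have : rho_expo nu \in map snd e by apply: contraR cnu => /coef_out ->.
  by case/mapP => p pe ->; apply: dome.
have expand (K' : fieldType) (f' : {rmorphism L -> K'}) y' := ev_alternant char2 anti f' y' uS pS hS.
pose T := in_tuple S.
have unitT := interp_unitmx (S := T) uS (fun i => pS _ (mem_tnth i T)).
pose v : 'rV[L]_(size S) := \row_i coef e (rho_expo (tnth T i)).
have v0 : v = 0.
  have := unitT; rewrite -(map_unitmx iota) => /mulmxK K0; apply: (can_inj (K0 _)).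
  rewrite mul0mx.
  apply/rowP => j; rewrite !mxE.
  have Tj := mem_tnth j T.
  rewrite -[RHS](vane _ (pS _ Tj) (dS _ Tj)) expand [RHS]big_tnth; apply: eq_bigr => i _.
  rewrite !mxE /=; congr (_ * _); rewrite rmorph_sum; apply: eq_bigr => w _.
  rewrite rmorphM rmorph_bc_sign rmorph_prod; congr (_ * _).
  by apply: eq_bigr => k _; rewrite fmorphXz.
rewrite expand big_tnth big1 // => i _.
by have := congr1 (fun M : 'rV_(size S) => M 0 i) v0; rewrite !mxE => ->; rewrite rmorph0 mul0r.
Qed.

Section Difference.
Variables (L : fieldType) (n : nat) (s t u r : L).
Variables (P : laurent Kqts n) (g g0 : Kqts -> L).
Hypothesis symP : bc_symmetric P.
Local Notation x := (@rf_var L n).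
Local Notation num := (op_num s t u r P g).

(** The Weyl denominator times P, that is, the left-hand side without the
    eigenvalue; g0 embeds the coefficients. *)
Definition op_den : lexpr L n :=
  lmul (den_list L n) (scaled_poly g0 P 1 [ffun=> false]).

Lemma ev_op_den (K : fieldType) (f : {rmorphism L -> K}) (y : 'I_n -> K) :
  (forall i, y i != 0) ->
  ev f y op_den = weyl_den y * leval (fun c => f (g0 c)) P y.
Proof.
move=> y0; rewrite ev_mul // ev_den_list // ev_scaled_poly; congr (_ * _).
by apply: eq_leval => i; rewrite rmorph1 exp1rz mulr1.
Qed.

Lemma ev_op_den_bc (K : fieldType) (f : {rmorphism L -> K}) w (y : 'I_n -> K) :
  (forall i, y i != 0) -> ev f (bc_point w y) op_den = bc_sign K w * ev f y op_den.
Proof.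
move=> y0; rewrite ev_op_den; last exact: bc_point_neq0.
rewrite ev_op_den // weyl_den_bc leval_bc //. by rewrite -[LHS]mulrA.
Qed.

Lemma ev_op_diff_bc (K : fieldType) (f : {rmorphism L -> K}) w (y : 'I_n -> K) (c : L) :
  (forall i, y i != 0) ->
  ev f (bc_point w y) (num ++ lscale c op_den) = bc_sign K w * ev f y (num ++ lscale c op_den).
Proof.
move=> y0; rewrite !ev_cat !ev_scale ev_op_num_bc // ev_op_den_bc //.
by rewrite mulrCA mulrDr.
Qed.

Lemma op_den_top (lam : n.-tuple nat) :
  is_part lam -> is_interpolation P lam -> g0 1 = 1 -> has_top op_den (rho_expo lam) 1.
Proof.
move=> plam intP g01; rewrite -sum_unit_expo_rho addrA -[X in has_top _ _ X]mulr1.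
apply: has_top_mul; first exact: den_list_top.
rewrite [X in has_top _ _ X](_ : 1 = monom (fun i => 1 ^ sg ([ffun=> false] i)) (part_expo lam)).
  exact: scaled_poly_top.
by rewrite /monom big1 // => i _; rewrite !exp1rz.
Qed.

Lemma op_num_den_anti (c : L) w a :
  coef (num ++ lscale c op_den) (bc_act w a)
  = bc_sign L w * coef (num ++ lscale c op_den) a.
Proof.
apply: coef_anti => {}w; apply: ev_op_diff_bc; exact: rf_var_neq0.
Qed.

Lemma ev_op_num_generic : s != 0 ->
  ev (@rf_const L n) x num
  = weyl_den x * \sum_(sigma : {ffun 'I_n -> bool})
      (\prod_(i < n)
         ((1 - rf_const n s * x i ^ sg (sigma i))
           * (1 - rf_const n u * x i ^ sg (sigma i) / rf_const n s)
           / (1 - x i ^ (2 * sg (sigma i)))))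
      * (\prod_(i < n) \prod_(j < n | (i < j)%N)
           ((1 - rf_const n t * x i ^ sg (sigma i) * x j ^ sg (sigma j))
             / (1 - x i ^ sg (sigma i) * x j ^ sg (sigma j))))
      * leval (fun c => rf_const n (g c)) P
          (fun i => x i * rf_const n r ^ sg (sigma i)).
Proof.
move=> s0; have x0 := @rf_var_neq0 L n.
rewrite ev_op_num // mulr_sumr; apply: eq_bigr => sigma _.
have ratio := @weyl_den_ratio _ n (rf_const n s) (rf_const n t) (rf_const n u) x sigma.
rewrite ev_op_term // 2!mulrA -[X in X * leval _ _ _ = _]mulrA -ratio.
- rewrite -[LHS]mulrA; congr (_ * (_ * _ * _)).
  apply: eq_bigr => i _; congr (_ / (1 - _)).
  by rewrite /flip mulrC -exprz_exp.
- by rewrite fmorph_eq0.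
- exact: x0.
- move=> i; rewrite /flip expr2 -!monom_unit_expo -monomD //; apply: generic_monom_neq1.
  by apply/eqP => /ffunP/(_ i); rewrite !ffunE eqxx; case: (sigma i).
move=> i j ij; rewrite /flip -!monom_unit_expo -monomD //; apply: generic_monom_neq1.
apply/eqP => /ffunP/(_ i); rewrite !ffunE eqxx -val_eqE ltn_eqF //=.
by case: (sigma i).
Qed.
End Difference.

Theorem corollary3p4 (n : nat) (n_gt0 : (1 <= n)%N)
    (lam : n.-tuple nat) (lam_part : is_part lam)
    (P : laurent Kqts n) (P_interp : is_interpolation P lam)
    (L : fieldType) (iota : {rmorphism Kqts -> L}) (u : L) :
  let emb (c : Kqts) : ratfun L n := rf_const n (iota c) in
  let x : 'I_n -> ratfun L n := @rf_var L n in
  let s' := emb s in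
  let t' := emb t in
  let u' := rf_const n u in
  emb (sqrtq ^- sumn lam)
    * (\prod_(i < n) (1 - emb (q ^+ tnth lam i * t ^+ (n - i.+1)) * u'))
    * leval emb P x
  = \sum_(sigma : {ffun 'I_n -> bool})
      (\prod_(i < n)
         ((1 - s' * x i ^ sg (sigma i)) * (1 - u' * x i ^ sg (sigma i) / s')
           / (1 - x i ^ (2 * sg (sigma i)))))
      * (\prod_(i < n) \prod_(j < n | (i < j)%N)
           ((1 - t' * x i ^ sg (sigma i) * x j ^ sg (sigma j))
             / (1 - x i ^ sg (sigma i) * x j ^ sg (sigma j))))
      * leval (fun c => emb (shift_s c)) P
          (fun i => x i * emb sqrtq ^ sg (sigma i)).
Proof.
move=> emb x s' t' u'.
have s0 : iota s != 0 by rewrite fmorph_eq0 /s tofrac_eq0 polyX_eq0.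
have r0 : iota sqrtq != 0.
  by rewrite fmorph_eq0 /sqrtq tofrac_eq0 polyC_eq0 /sqrtq0 tofrac_eq0 -msupp_eq0 msuppX.
have [symP _ vanP] := P_interp.
pose E := op_eigenvalue (iota t) u (iota sqrtq) lam.
pose num := op_num (iota s) (iota t) u (iota sqrtq) P (iota \o shift_s).
pose den := op_den P iota.
have e0 : ev (@rf_const L n) x (num ++ lscale (- E) den) = 0.
  apply: (antisymmetric_interpolation (iota := iota) (lam := lam)).
  - exact: op_num_den_anti.
  - have -> : 0 = E + - E * 1 by rewrite mulr1 subrr.
    apply: has_top_cat; first by apply: op_num_top; rewrite //= !rmorph1.
    by apply: has_top_scale; apply: op_den_top; rewrite // rmorph1.
  move=> nu pnu dnu; rewrite ev_cat ev_scale (op_num_vanish P_interp) // add0r ev_op_den; last first.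
    by move=> i; rewrite fmorph_eq0 interp_point_neq0.
  rewrite [leval _ _ _](_ : _ = iota (leval id P (interp_point nu))); last first.
    rewrite !leval_monom rmorph_sum; apply: eq_bigr => a _.
    rewrite rmorphM rmorph_prod; congr (_ * _); apply: eq_bigr => i _.
    by rewrite fmorphXz.
  by rewrite vanP // rmorph0 !mulr0.
apply: (mulfI (generic_weyl_den_neq0 L n)).
move: e0; rewrite ev_cat ev_scale rmorphN mulNr => /subr0_eq.
rewrite ev_op_num_generic // ev_op_den; last exact: rf_var_neq0.
move=> e0; apply: etrans (esym e0).
rewrite mulrCA; congr (_ * _); rewrite /E /op_eigenvalue rmorphM rmorph_prod /emb.
congr (_ * _); first by rewrite !fmorphV !rmorphXn.
apply: eq_bigr => i _; rewrite rmorphB rmorph1 rmorphM /q.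
by rewrite !rmorphM !rmorphXn.
Qed.
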